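(* For any set $A \subseteq \mathbb{N}$ of positive lower density, there is an infinite subset of $A$ which is not of PA degree.
   Context: The lower density of $A \subseteq \mathbb{N}$ is $\liminf_{n\to\infty} \frac{|A \cap \{0,\ldots,n\}|}{n+1}$. A completion of a partial function $f\colon \mathbb{N}\to\{0,1\}$ is a total function $g\colon\mathbb{N}\to\{0,1\}$ agreeing with $f$ on the domain of $f$. A set $B$ is of PA degree if for every partial computable function $f\colon \mathbb{N}\to\{0,1\}$, $B$ computes a completion of $f$. *)

(* Defs.v *)
From mathcomp Require Import all_boot all_order all_algebra.
From mathcomp Require Import boolp classical_sets cardinality reals.
From mathcomp Require Import topology normedtype sequences.

Set Implicit Arguments.
Unset Strict Implicit.
Unset Printing Implicit Defensive.

Import Order.TTheory GRing.Theory Num.Theory.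

Local Open Scope classical_set_scope.
Local Open Scope ring_scope.

(* In the cardinality, [i] ranges over ['I_n.+1], that is {0, ..., n}. *)
Definition lower_density (R : realType) (A : set nat) : R :=
  limn_inf (fun n : nat =>
    #|[pred i : 'I_n.+1 | (i : nat) \in A]|%:R / n.+1%:R).

Local Close Scope ring_scope.
Local Open Scope nat_scope.

(* Programs for the (oracle) mu-recursive functions. Arities are not tracked:
   a program acts on a list of arguments, in which a missing argument counts as
   0 and a superfluous one is ignored; this does not change which functions are
   computable. *)
Inductive code : Type :=
| Zero
| Succ
| Proj of nat
| Oracle
| Comp of code & seq code
| Rec of code & code
| Mu of code.

Definition pointwise (T U : Type) (r : T -> U -> Prop) :
    seq T -> seq U -> Prop :=
  fix loop s t := match s, t with
  | [::], [::] => True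
  | x :: s', y :: t' => r x y /\ loop s' t'
  | _, _ => False
  end.

(* [eval B c v y]: the program [c] with oracle [B] halts on the arguments [v]
   with output [y].
   - In [Rec f g], [s i] is the value at recursion argument [i]; the step
     function [g] receives [i], then [s i], then the parameters.
   - [Mu f] is unbounded search for the least zero of [f] in its first argument;
     it diverges if [f] diverges before reaching that zero. *)
Fixpoint eval (B : set nat) (c : code) (v : seq nat) (y : nat) {struct c} :
    Prop :=
  match c with
  | Zero => y = 0
  | Succ => y = (head 0 v).+1
  | Proj i => y = nth 0 v i
  | Oracle => y = nat_of_bool (head 0 v \in B)
  | Comp f gs =>
      exists2 w, pointwise (fun g z => eval B g v z) gs w & eval B f w y
  | Rec f g =>
      exists s : nat -> nat,
        [/\ eval B f (behead v) (s 0),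
            forall i, i < head 0 v ->
              eval B g [:: i, s i & behead v] (s i.+1)
          & y = s (head 0 v)]
  | Mu f =>
      eval B f (y :: v) 0 /\
      forall i, i < y -> exists k, eval B f (i :: v) k.+1
  end.

Fixpoint oracle_free (c : code) : bool :=
  match c with
  | Zero | Succ | Proj _ => true
  | Oracle => false
  | Comp f gs => oracle_free f && all oracle_free gs
  | Rec f g => oracle_free f && oracle_free g
  | Mu f => oracle_free f
  end.

(* A partial function is total into [option], with [None] where undefined. *)
Definition computes (B : set nat) (c : code) (f : nat -> option bool) : Prop :=
  forall x y, eval B c [:: x] y <-> omap nat_of_bool (f x) = Some y.

(* The oracle [set0] is a dummy: it is never queried. *)
Definition partial_computable (f : nat -> option bool) : Prop :=
  exists2 c, oracle_free c & computes set0 c f.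

Definition computable_from (B : set nat) (g : nat -> bool) : Prop :=
  exists c, computes B c (fun x => Some (g x)).

Definition completion (f : nat -> option bool) (g : nat -> bool) : Prop :=
  forall x b, f x = Some b -> g x = b.

Definition PA_degree (B : set nat) : Prop :=
  forall f : nat -> option bool, partial_computable f ->
    exists2 g : nat -> bool, completion f g & computable_from B g.

(* Main.v *)
(** Call a set V bad for a program relative to a finite set F if there is an input
    on which the program diverges with every oracle F u G, G included in V. A
    program is defeated either by a finite extension inside A that makes it
    disagree with f, or by staying inside a bad set.

    Fix finitely many sets V_j, with programs for which no finite extension
    inside A n V_j disagrees with f. By compactness, and since f diagonalizes
    against all c.e. sets, there are for every N configurations (X^p, V^p),
    p < 2^N, with the same closed properties as (A, V) (the density of A
    included), such that the programs agree on X^p n V_j^p with the p-th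
    valuation of N inputs. Hence X^p n V_j^p n X^q n V_j^q is bad for p <> q, and
    if N is large these intersections fill a positive fraction of every window
    [n, C n).

    A itself may avoid the bad sets in infinitely many windows, so that the
    programs cannot be treated one after the other on shrinking parts of A.
    Instead one keeps finite families of pieces for all levels 1, ..., i at once,
    a piece of level j + 1 refining a condition of level j, and lets their
    densities be lexicographically maximal among those attained in almost all
    windows. In every window the intersections above either raise one of these
    densities, which by maximality cannot happen in almost all windows, or give
    a piece of level i + 1. The conditions found in this way form an infinite,
    finitely branching tree, and the union along an infinite path is the required
    subset of A. *)

From HB Require Import structures.
Require Import Defs.
From mathcomp Require Import all_boot all_order all_algebra.
From mathcomp Require Import boolp classical_sets cardinality reals.
From mathcomp Require Import zify.
From mathcomp Require topology normedtype sequences.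

Set Implicit Arguments.
Unset Strict Implicit.
Unset Printing Implicit Defensive.

Local Open Scope classical_set_scope.
Local Open Scope nat_scope.

(** * Computable functions *)

Lemma code_nested_ind (P : code -> Prop) :
  P Zero -> P Succ -> (forall i, P (Proj i)) -> P Oracle ->
  (forall f gs, P f -> List.Forall P gs -> P (Comp f gs)) ->
  (forall f g, P f -> P g -> P (Rec f g)) ->
  (forall f, P f -> P (Mu f)) ->
  forall c, P c.
Proof.
move=> PZ PS PP PO PC PR PM.
fix IH 1 => -[||i||f gs|f g|f].
- exact: PZ.
- exact: PS.
- exact: PP.
- exact: PO.
- apply: PC; first exact: IH.
  by elim: gs => [|g gs IHgs]; constructor; [exact: IH|exact: IHgs].
- by apply: PR; exact: IH.
- by apply: PM; exact: IH.
Qed.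

Lemma eval_fun B c v y y' : eval B c v y -> eval B c v y' -> y = y'.
Proof.
elim/code_nested_ind: c v y y' => //=.
- by move=> v y y' -> ->.
- by move=> v y y' -> ->.
- by move=> i v y y' -> ->.
- by move=> v y y' -> ->.
- move=> f gs IHf IHgs v y y' [w gsw fw] [w' gsw' fw'].
  suff ww' : w = w' by apply: IHf fw _; rewrite ww'.
  elim: IHgs w w' gsw gsw' {fw fw'} => [|g gs' IHg _ IH] [|z w] [|z' w'] //=.
  move=> [gz gsw] [gz' gsw']; congr (_ :: _); first exact: IHg gz gz'.
  exact: IH.
- move=> f g IHf IHg v y y' [s [s0 sS ->]] [s' [s'0 s'S ->]].
  have : forall i, i <= head 0 v -> s i = s' i.
    elim=> [_|i IHi lti]; first exact: IHf s0 s'0.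
    by apply: IHg (sS i lti) _; rewrite IHi ?(ltnW lti)//; exact: s'S.
  by apply.
- move=> f IHf v y y' [fy yl] [fy' y'l]; apply/eqP; rewrite eqn_leq.
  apply/andP; split; rewrite leqNgt; apply/negP => lt.
    by have [k fk] := yl _ lt; have := IHf _ _ _ fk fy'.
  by have [k fk] := y'l _ lt; have := IHf _ _ _ fk fy.
Qed.

(** One program serves all oracles [Z], so [h] is a functional of [Z]. This uniformity lets a single
    program test properties of all configurations, which are coded as oracles. *)
Definition computableL (h : (nat -> bool) -> seq nat -> nat) :=
  exists c, forall (Z : nat -> bool) v, eval [set i | Z i] c v (h Z v).

Lemma computableL_ext h h' : (forall Z v, h Z v = h' Z v) ->
  computableL h -> computableL h'.
Proof. by move=> hh' [c hc]; exists c => Z v; rewrite -hh'. Qed.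

Lemma computableL_proj i : computableL (fun _ v => nth 0 v i).
Proof. by exists (Proj i) => Z v. Qed.

Lemma computableL_comp1 F a : computableL F -> computableL a ->
  computableL (fun Z v => F Z [:: a Z v]).
Proof.
move=> [cF HF] [ca Ha]; exists (Comp cF [:: ca]) => Z v /=.
by exists [:: a Z v] => //; split.
Qed.

Lemma computableL_comp2 F a b : computableL F -> computableL a ->
  computableL b -> computableL (fun Z v => F Z [:: a Z v; b Z v]).
Proof.
move=> [cF HF] [ca Ha] [cb Hb]; exists (Comp cF [:: ca; cb]) => Z v /=.
by exists [:: a Z v; b Z v] => //; do !split.
Qed.

Lemma computableL_rec f g : computableL f -> computableL g ->
  computableL (fun Z v =>
    iteri (head 0 v) (fun i r => g Z [:: i, r & behead v]) (f Z (behead v))).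
Proof.
move=> [cf Hf] [cg Hg]; exists (Rec cf cg) => Z v /=.
by exists (fun n =>
  iteri n (fun i r => g Z [:: i, r & behead v]) (f Z (behead v))); split.
Qed.

Lemma computableL_const n : computableL (fun _ _ => n).
Proof.
elim: n => [|n [c Hc]]; first by exists Zero.
by exists (Comp Succ [:: c]) => Z v /=; exists [:: n].
Qed.

Lemma computableL_succ a : computableL a -> computableL (fun Z v => (a Z v).+1).
Proof.
have S : computableL (fun _ v => (head 0 v).+1) by exists Succ.
by move=> /(computableL_comp1 S).
Qed.

Lemma computableL_pred a : computableL a -> computableL (fun Z v => (a Z v).-1).
Proof.
have P := computableL_rec (computableL_const 0) (computableL_proj 0).
move=> /(computableL_comp1 P); apply: computableL_ext => Z v /=.
by case: (a Z v).
Qed.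

Lemma computableL_add a b : computableL a -> computableL b ->
  computableL (fun Z v => a Z v + b Z v).
Proof.
have P := computableL_rec (computableL_proj 0)
  (computableL_succ (computableL_proj 1)).
move=> Ha Hb; have := computableL_comp2 P Ha Hb.
apply: computableL_ext => Z v /=; by elim: (a Z v) => //= n ->.
Qed.

Lemma computableL_sub a b : computableL a -> computableL b ->
  computableL (fun Z v => a Z v - b Z v).
Proof.
have P := computableL_rec (computableL_proj 0)
  (computableL_pred (computableL_proj 1)).
move=> Ha Hb; have := computableL_comp2 P Hb Ha.
apply: computableL_ext => Z v /=.
by elim: (b Z v) => [|n /= ->]; [rewrite subn0|rewrite subnS].
Qed.

Lemma computableL_mul a b : computableL a -> computableL b ->
  computableL (fun Z v => a Z v * b Z v).
Proof.
have P := computableL_rec (computableL_const 0)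
  (computableL_add (computableL_proj 1) (computableL_proj 2)).
move=> Ha Hb; have := computableL_comp2 P Ha Hb.
apply: computableL_ext => Z v /=.
by elim: (a Z v) => [|n /= ->]; rewrite ?mul0n ?mulSn // addnC.
Qed.

(** The value is at least (a + b)^2 and less than (a + b + 1)^2, so the integer square root returns
    a + b, and from it a and b. The map is injective but not onto. *)
HB.lock Definition cpair a b := (a + b) * (a + b) + a.
(** The increment is 1 exactly when (r + 1)^2 <= i + 1, expressed by truncated subtraction. *)
Definition csqrt n :=
  iteri n (fun i r => r + (1 - (r.+1 * r.+1 - i.+1))) 0.
HB.lock Definition cfst z := z - csqrt z * csqrt z.
HB.lock Definition csnd z := csqrt z - cfst z.

Lemma csqrtP n : csqrt n * csqrt n <= n < (csqrt n).+1 * (csqrt n).+1.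
Proof.
elim: n => [//|n].
have -> : csqrt n.+1 = csqrt n + (1 - ((csqrt n).+1 * (csqrt n).+1 - n.+1)).
  by [].
set s := csqrt n => /andP[H1 H2].
have -> : 1 - (s.+1 * s.+1 - n.+1) = (s.+1 * s.+1 <= n.+1) by lia.
by case: leqP => H /=; rewrite ?addn0 ?addn1; lia.
Qed.

Lemma csqrt_cpair a b : csqrt (cpair a b) = a + b.
Proof.
have := csqrtP (cpair a b); move: (csqrt _) => s; rewrite cpair.unlock.
move=> /andP[H1 H2]; apply/eqP; rewrite eqn_leq.
apply/andP; split; rewrite leqNgt; apply/negP => H.
  have := leq_mul H H; lia.
by have := leq_mul H H; lia.
Qed.

Lemma cfst_cpair a b : cfst (cpair a b) = a.
Proof. by rewrite cfst.unlock csqrt_cpair cpair.unlock; lia. Qed.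

Lemma csnd_cpair a b : csnd (cpair a b) = b.
Proof. by rewrite csnd.unlock csqrt_cpair cfst_cpair; lia. Qed.

Lemma cfst0 : cfst 0 = 0.
Proof. by rewrite cfst.unlock. Qed.

Lemma csnd0 : csnd 0 = 0.
Proof. by rewrite csnd.unlock. Qed.

Definition cpairE := (cfst_cpair, csnd_cpair).

(* Functions of several arguments are made unary with [cpair]. *)
Definition computable (h : (nat -> bool) -> nat -> nat) :=
  computableL (fun Z v => h Z (head 0 v)).

Lemma computable_ext h h' : (forall Z x, h Z x = h' Z x) ->
  computable h -> computable h'.
Proof. by move=> hh'; apply: computableL_ext => Z v. Qed.

Lemma computable_id : computable (fun _ x => x).
Proof. by apply: computableL_ext (computableL_proj 0) => Z []. Qed.

Lemma computable_const n : computable (fun _ _ => n).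
Proof. exact: computableL_const. Qed.

Lemma computable_comp F a : computable F -> computable a ->
  computable (fun Z x => F Z (a Z x)).
Proof. exact: computableL_comp1. Qed.

Lemma computable_oracle a : computable a -> computable (fun Z x => Z (a Z x)).
Proof.
apply: (@computable_comp (fun Z x => Z x)); exists Oracle => Z v /=.
by congr nat_of_bool; apply/esym/(asboolb (Z _)).
Qed.

Lemma computable_succ a : computable a -> computable (fun Z x => (a Z x).+1).
Proof. exact: computableL_succ. Qed.

Lemma computable_pred a : computable a -> computable (fun Z x => (a Z x).-1).
Proof. exact: computableL_pred. Qed.

Lemma computable_add a b : computable a -> computable b ->
  computable (fun Z x => a Z x + b Z x).
Proof. exact: computableL_add. Qed.

Lemma computable_sub a b : computable a -> computable b ->
  computable (fun Z x => a Z x - b Z x).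
Proof. exact: computableL_sub. Qed.

Lemma computable_mul a b : computable a -> computable b ->
  computable (fun Z x => a Z x * b Z x).
Proof. exact: computableL_mul. Qed.

Lemma computableL_cpair a b : computableL a -> computableL b ->
  computableL (fun Z v => cpair (a Z v) (b Z v)).
Proof.
move=> Ha Hb; have Hs := computableL_add Ha Hb.
apply: computableL_ext (computableL_add (computableL_mul Hs Hs) Ha) => Z v.
by rewrite cpair.unlock.
Qed.

Lemma computable_cpair a b : computable a -> computable b ->
  computable (fun Z x => cpair (a Z x) (b Z x)).
Proof. exact: computableL_cpair. Qed.

Lemma computable_csqrt a : computable a -> computable (fun Z x => csqrt (a Z x)).
Proof.
apply: (@computable_comp (fun Z x => csqrt x)).
have H1 := computableL_succ (computableL_proj 1).
have H := computableL_sub (computableL_const 1)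
  (computableL_sub (computableL_mul H1 H1)
                   (computableL_succ (computableL_proj 0))).
exact: computableL_rec (computableL_const 0)
  (computableL_add (computableL_proj 1) H).
Qed.

Lemma computable_cfst a : computable a -> computable (fun Z x => cfst (a Z x)).
Proof.
move=> Ha; rewrite cfst.unlock; apply: computable_sub => //.
by apply: computable_mul; apply: computable_csqrt.
Qed.

Lemma computable_csnd a : computable a -> computable (fun Z x => csnd (a Z x)).
Proof.
move=> Ha; rewrite csnd.unlock; apply: computable_sub.
  exact: computable_csqrt.
exact: computable_cfst.
Qed.

Lemma computable_iteri (G : (nat -> bool) -> nat -> nat -> nat -> nat) n a :
  computable n -> computable a ->
  computable (fun Z u => G Z (cfst u) (cfst (csnd u)) (csnd (csnd u))) ->
  computable (fun Z x => iteri (n Z x) (G Z x) (a Z x)).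
Proof.
move=> Hn Ha HG.
have HG' : computableL (fun Z v => G Z (nth 0 v 2) (nth 0 v 0) (nth 0 v 1)).
  have P := computableL_cpair (computableL_proj 2)
    (computableL_cpair (computableL_proj 0) (computableL_proj 1)).
  apply: computableL_ext (computableL_comp1 HG P) => Z v /=.
  by rewrite !cpairE.
have R := computableL_rec Ha HG'.
apply: computableL_ext (computableL_comp2 R Hn computable_id) => Z v /=.
by elim: (n Z _) => //= m ->.
Qed.

Lemma computable_leq a b : computable a -> computable b ->
  computable (fun Z x => a Z x <= b Z x).
Proof.
move=> Ha Hb.
apply: computable_ext (computable_sub (computable_const 1)
  (computable_sub Ha Hb)) => Z x.
by case: leqP; lia.
Qed.

Lemma computable_eq a b : computable a -> computable b ->
  computable (fun Z x => a Z x == b Z x).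
Proof.
move=> Ha Hb.
apply: computable_ext (computable_mul (computable_leq Ha Hb)
  (computable_leq Hb Ha)) => Z x.
by rewrite eqn_leq mulnb.
Qed.

Lemma computable_neg (P : (nat -> bool) -> nat -> bool) :
  computable P -> computable (fun Z x => ~~ P Z x).
Proof.
move=> HP; apply: computable_ext (computable_sub (computable_const 1) HP) => Z x.
by case: (P Z x).
Qed.

Lemma computable_and (P Q : (nat -> bool) -> nat -> bool) :
  computable P -> computable Q -> computable (fun Z x => P Z x && Q Z x).
Proof.
move=> HP HQ; apply: computable_ext (computable_mul HP HQ) => Z x.
by case: (P Z x); case: (Q Z x).
Qed.

Lemma computable_or (P Q : (nat -> bool) -> nat -> bool) :
  computable P -> computable Q -> computable (fun Z x => P Z x || Q Z x).
Proof.
move=> /computable_neg HP /computable_neg HQ.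
apply: computable_ext (computable_neg (computable_and HP HQ)) => Z x.
by rewrite negb_and !negbK.
Qed.

Lemma computable_imply (P Q : (nat -> bool) -> nat -> bool) :
  computable P -> computable Q -> computable (fun Z x => P Z x ==> Q Z x).
Proof.
move=> /computable_neg HP HQ.
by apply: computable_ext (computable_or HP HQ) => Z x; rewrite implybE.
Qed.

Lemma computable_if (P : (nat -> bool) -> nat -> bool) a b :
  computable P -> computable a -> computable b ->
  computable (fun Z x => if P Z x then a Z x else b Z x).
Proof.
move=> HP Ha Hb; apply: computable_ext (computable_add (computable_mul HP Ha)
  (computable_mul (computable_neg HP) Hb)) => Z x.
by case: (P Z x) => /=; lia.
Qed.

Lemma computable_ifb (P Q Q' : (nat -> bool) -> nat -> bool) :
  computable P -> computable Q -> computable Q' ->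
  computable (fun Z x => if P Z x then Q Z x else Q' Z x).
Proof.
move=> HP HQ HQ'; apply: computable_ext (computable_if HP HQ HQ') => Z x.
by case: (P Z x).
Qed.

Lemma computable_exp a b : computable a -> computable b ->
  computable (fun Z x => a Z x ^ b Z x).
Proof.
move=> Ha Hb.
suff H : computable (fun Z x => iteri (b Z x) (fun _ r => a Z x * r) 1).
  by apply: computable_ext H => Z x; elim: (b Z x) => //= n ->; rewrite expnS.
apply: (@computable_iteri (fun Z x _ r => a Z x * r)) => //.
  exact: computable_const.
apply: computable_mul.
  exact: computable_comp Ha (computable_cfst computable_id).
by do 2 apply: computable_csnd; exact: computable_id.
Qed.

Lemma computable_all (P : (nat -> bool) -> nat -> nat -> bool) n :
  computable n -> computable (fun Z u => P Z (cfst u) (csnd u)) ->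
  computable (fun Z x => all (P Z x) (iota 0 (n Z x))).
Proof.
move=> Hn HP.
suff H : computable (fun Z x => iteri (n Z x) (fun i r => P Z x i * r) 1).
  apply: computable_ext H => Z x; elim: (n Z x) => // m IH.
  have -> : iota 0 m.+1 = rcons (iota 0 m) m by rewrite -cats1 -addn1 iotaD.
  by rewrite all_rcons /= IH mulnb.
apply: (@computable_iteri (fun Z x i r => P Z x i * r)) => //.
  exact: computable_const.
have Hu : computable (fun _ u => cpair (cfst u) (cfst (csnd u))).
  apply: computable_cpair; first exact: computable_cfst computable_id.
  exact: computable_cfst (computable_csnd computable_id).
apply: computable_mul; last exact: computable_csnd (computable_csnd computable_id).
by apply: computable_ext (computable_comp HP Hu) => Z u; rewrite !cpairE.
Qed.

Lemma computable_has (P : (nat -> bool) -> nat -> nat -> bool) n :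
  computable n -> computable (fun Z u => P Z (cfst u) (csnd u)) ->
  computable (fun Z x => has (P Z x) (iota 0 (n Z x))).
Proof.
move=> Hn HP.
have /computable_neg := @computable_all (fun Z x i => ~~ P Z x i) _ Hn
  (computable_neg HP).
by apply: computable_ext => Z x; rewrite all_predC negbK.
Qed.

Lemma computable_sum (P : (nat -> bool) -> nat -> nat -> nat) n :
  computable n -> computable (fun Z u => P Z (cfst u) (csnd u)) ->
  computable (fun Z x => \sum_(0 <= i < n Z x) P Z x i).
Proof.
move=> Hn HP.
suff H : computable (fun Z x => iteri (n Z x) (fun i r => r + P Z x i) 0).
  apply: computable_ext H => Z x; elim: (n Z x) => [|m IH].
    by rewrite big_nil.
  by rewrite big_nat_recr//= IH.
apply: (@computable_iteri (fun Z x i r => r + P Z x i)) => //.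
  exact: computable_const.
have Hu : computable (fun _ u => cpair (cfst u) (cfst (csnd u))).
  apply: computable_cpair; first exact: computable_cfst computable_id.
  exact: computable_cfst (computable_csnd computable_id).
apply: computable_add; first exact: computable_csnd (computable_csnd computable_id).
by apply: computable_ext (computable_comp HP Hu) => Z u; rewrite !cpairE.
Qed.

Lemma computable_iter (F : nat -> nat) n a :
  computable (fun _ x => F x) -> computable n -> computable a ->
  computable (fun Z x => iter (n Z x) F (a Z x)).
Proof.
move=> HF Hn Ha.
suff H : computable (fun Z x => iteri (n Z x) (fun _ r => F r) (a Z x)).
  by apply: computable_ext H => Z x; elim: (n Z x) => //= m ->.
apply: (@computable_iteri (fun _ _ _ r => F r)) => //.
exact: computable_comp HF (computable_csnd (computable_csnd computable_id)).
Qed.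

Lemma computable_odd a : computable a -> computable (fun Z x => odd (a Z x)).
Proof.
move=> Ha.
suff H : computable (fun Z x => iter (a Z x) (fun r => 1 - r) 0).
  by apply: computable_ext H => Z x; elim: (a Z x) => //= m ->; case: odd.
apply: computable_iter => //; last exact: computable_const.
exact: computable_sub (computable_const 1) computable_id.
Qed.

Lemma computable_half a : computable a -> computable (fun Z x => (a Z x)./2).
Proof.
move=> Ha.
suff H : computable (fun Z x => iteri (a Z x) (fun i r => odd i + r) 0).
  by apply: computable_ext H => Z x; elim: (a Z x) => //= m ->; rewrite uphalf_half.
apply: (@computable_iteri (fun _ _ i r => odd i + r)) => //.
  exact: computable_const.
have H := computable_csnd computable_id.
by apply: computable_add; [apply/computable_odd/computable_cfst|apply/computable_csnd].
Qed.

(** The i-th binary digit of [r]: a number stands for a finite set, or for a finite oracle. *)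
Definition bit i r := odd (iter i half r).
Arguments bit : simpl never.

Lemma computable_bit a b : computable a -> computable b ->
  computable (fun Z x => bit (a Z x) (b Z x)).
Proof.
move=> Ha Hb; apply: computable_odd; apply: computable_iter => //.
exact: computable_half computable_id.
Qed.

(** The converse coding: an initial segment of length [n] of [b] becomes a number below 2^n. *)
Definition tab n (b : nat -> bool) := \sum_(0 <= i < n) b i * 2 ^ i.
Arguments tab : simpl never.

Lemma tab0 b : tab 0 b = 0. Proof. by rewrite /tab big_nil. Qed.

Lemma tabS n b : tab n.+1 b = b 0 + (tab n (b \o succn)).*2.
Proof.
rewrite /tab big_nat_recl// muln1; congr (_ + _).
rewrite -mul2n big_distrr /=; apply: eq_bigr => i _.
by rewrite expnS mulnCA.
Qed.

Lemma bit_tab i n b : bit i (tab n b) = (i < n) && b i.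
Proof.
elim: n i b => [|n IH] i b.
  by rewrite tab0 /bit; elim: i => // i IH; rewrite iterSr.
case: i => [|i]; rewrite tabS /bit /=.
  by rewrite oddD odd_double addbF; case: (b 0).
by rewrite -iterS iterSr half_bit_double -/(bit i _) IH ltnS.
Qed.

Lemma tab_lt n b : tab n b < 2 ^ n.
Proof.
elim: n b => [|n IH] b; first by rewrite tab0.
by rewrite tabS expnS; have := IH (b \o succn); case: (b 0) => /=; lia.
Qed.

Lemma eq_tab n b b' : (forall i, i < n -> b i = b' i) -> tab n b = tab n b'.
Proof.
move=> bb'; rewrite /tab !big_mkord; apply: eq_bigr => i _.
by rewrite bb'.
Qed.

Lemma tab_bit n z : z < 2 ^ n -> tab n (bit^~ z) = z.
Proof.
elim: n z => [|n IH] z; first by rewrite expn0 tab0; case: z.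
rewrite expnS => zn; rewrite tabS.
have -> : tab n ((bit^~ z) \o succn) = z./2.
  rewrite -[RHS]IH; last by lia.
  by apply: eq_tab => i _; rewrite /bit /= -iterS iterSr.
by rewrite /bit /= odd_double_half.
Qed.

Lemma computable_tab (P : (nat -> bool) -> nat -> nat -> bool) n :
  computable n -> computable (fun Z u => P Z (cfst u) (csnd u)) ->
  computable (fun Z x => tab (n Z x) (P Z x)).
Proof.
move=> Hn HP; apply: (@computable_sum (fun Z x i => P Z x i * 2 ^ i)) => //.
apply: computable_mul => //; apply: computable_exp; first exact: computable_const.
exact: computable_csnd computable_id.
Qed.

(** The outermost operation selects the closure lemma; the patterns [@?a Z x] extract its operands
    as functions of [Z] and [x]. *)
Ltac computable_subterms := cbv beta;
  lazymatch goal with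
  | |- computable (fun _ x => x) => exact: computable_id
  | |- computable (fun _ _ => ?n) => exact: (computable_const n)
  | |- computable (fun Z x => cfst (@?a Z x)) => apply: (computable_cfst (a := a))
  | |- computable (fun Z x => csnd (@?a Z x)) => apply: (computable_csnd (a := a))
  | |- computable (fun Z x => cpair (@?a Z x) (@?b Z x)) =>
      apply: (computable_cpair (a := a) (b := b))
  | |- computable (fun Z x => nat_of_bool (@eq_op _ (@?a Z x) (@?b Z x))) =>
      apply: (computable_eq (a := a) (b := b))
  | |- computable (fun Z x => nat_of_bool (leq (@?a Z x) (@?b Z x))) =>
      apply: (computable_leq (a := a) (b := b))
  | |- computable (fun Z x => nat_of_bool (~~ (@?P Z x))) =>
      apply: (computable_neg (P := P))
  | |- computable (fun Z x => nat_of_bool ((@?P Z x) && (@?Q Z x))) =>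
      apply: (computable_and (P := P) (Q := Q))
  | |- computable (fun Z x => nat_of_bool ((@?P Z x) || (@?Q Z x))) =>
      apply: (computable_or (P := P) (Q := Q))
  | |- computable (fun Z x => nat_of_bool ((@?P Z x) ==> (@?Q Z x))) =>
      apply: (computable_imply (P := P) (Q := Q))
  | |- computable (fun Z x =>
        nat_of_bool (if _ then _ else _)) => apply: computable_ifb
  | |- computable (fun Z x => nat_of_bool (all (@?P Z x) (iota 0 (@?n Z x)))) =>
      apply: (computable_all (P := P) (n := n))
  | |- computable (fun Z x => nat_of_bool (has (@?P Z x) (iota 0 (@?n Z x)))) =>
      apply: (computable_has (P := P) (n := n))
  | |- computable (fun Z x => tab (@?n Z x) (@?P Z x)) =>
      apply: (computable_tab (P := P) (n := n))
  | |- computable (fun Z x => nat_of_bool (bit (@?a Z x) (@?b Z x))) =>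
      apply: (computable_bit (a := a) (b := b))
  | |- computable (fun Z x => nat_of_bool (Z (@?a Z x))) =>
      apply: (computable_oracle (a := a))
  | |- computable (fun Z x => S (@?a Z x)) => apply: (computable_succ (a := a))
  | |- computable (fun Z x => Nat.pred (@?a Z x)) =>
      apply: (computable_pred (a := a))
  | |- computable (fun Z x => addn (@?a Z x) (@?b Z x)) =>
      apply: (computable_add (a := a) (b := b))
  | |- computable (fun Z x => subn (@?a Z x) (@?b Z x)) =>
      apply: (computable_sub (a := a) (b := b))
  | |- computable (fun Z x => muln (@?a Z x) (@?b Z x)) =>
      apply: (computable_mul (a := a) (b := b))
  | |- computable (fun Z x => expn (@?a Z x) (@?b Z x)) =>
      apply: (computable_exp (a := a) (b := b))
  | H : computable ?h |- computable ?h => exact: H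
  end.
Ltac prove_computable := repeat computable_subterms.

(** * Evaluation by stages *)

(** Lists are coded with 0 as the empty list. Both projections of 0 vanish, so [lhd] and [ltl] agree
    with [head 0] and [behead] there too. *)
Definition lhd v := cfst v.-1.
Definition ltl v := csnd v.-1.
Definition lcons x v := (cpair x v).+1.
Arguments lhd : simpl never.
Arguments ltl : simpl never.
Arguments lcons : simpl never.

Lemma computable_ltl a : computable a -> computable (fun Z x => ltl (a Z x)).
Proof. by move=> Ha; rewrite /ltl; prove_computable. Qed.

Definition encs : seq nat -> nat := foldr lcons 0.

Lemma lhd_encs v : lhd (encs v) = head 0 v.
Proof. by case: v => [|x v]; rewrite /lhd ?cfst0 //= cpairE. Qed.

Lemma ltl_encs v : ltl (encs v) = encs (behead v).
Proof. by case: v => [|x v]; rewrite /ltl ?csnd0 //= cpairE. Qed.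

Lemma lnth_encs v i : lhd (iter i ltl (encs v)) = nth 0 v i.
Proof.
elim: i v => [|i IH] v; first by rewrite /= lhd_encs nth0.
by rewrite iterSr ltl_encs IH nth_behead.
Qed.

Fixpoint enc (c : code) : nat :=
  match c with
  | Zero => cpair 0 0
  | Succ => cpair 1 0
  | Proj i => cpair 2 i
  | Oracle => cpair 3 0
  | Comp f gs => cpair 4 (cpair (enc f)
      ((fix encl gs := match gs with
        | [::] => 0
        | g :: gs' => lcons (enc g) (encl gs')
        end) gs))
  | Rec f g => cpair 5 (cpair (enc f) (enc g))
  | Mu f => cpair 6 (enc f)
  end.

Lemma enc_Comp f gs :
  enc (Comp f gs) = cpair 4 (cpair (enc f) (encs (map enc gs))).
Proof. by congr (cpair 4 (cpair _ _)); elim: gs => //= g gs ->. Qed.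

(* Judgements: [jeval c v y] for the evaluation of a program, [jargs gs v w] for
   the evaluation of the list of programs [gs]. *)
Definition jeval c v y := cpair 0 (cpair c (cpair v y)).
Definition jargs gs v w := cpair 1 (cpair gs (cpair v w)).
Arguments jeval : simpl never.
Arguments jargs : simpl never.

Lemma jevalE c v y :
  ((cfst (jeval c v y) = 0) * (cfst (csnd (jeval c v y)) = c) *
   (cfst (csnd (csnd (jeval c v y))) = v) *
   (csnd (csnd (csnd (jeval c v y))) = y))%type.
Proof. by rewrite /jeval !cpairE. Qed.

Lemma jargsE gs v w :
  ((cfst (jargs gs v w) = 1) * (cfst (csnd (jargs gs v w)) = gs) *
   (cfst (csnd (csnd (jargs gs v w))) = v) *
   (csnd (csnd (csnd (jargs gs v w))) = w))%type.
Proof. by rewrite /jargs !cpairE. Qed.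

(* [step B s look j]: the judgement [j] follows in one step from judgements
   satisfying [look], all parameters and oracle queries being below [s]. *)
Definition step (B : nat -> bool) (s : nat) (look : nat -> bool) (j : nat) :=
  let c := cfst (csnd j) in
  let v := cfst (csnd (csnd j)) in
  let y := csnd (csnd (csnd j)) in
  let a := csnd c in
  if cfst j == 0 then
    [|| (cfst c == 0) && (y == 0),
        (cfst c == 1) && (y == (lhd v).+1),
        (cfst c == 2) && (y == lhd (iter a ltl v)),
        (cfst c == 3) && ((lhd v < s) && (y == B (lhd v))),
        (cfst c == 4) && has (fun w =>
           look (jargs (csnd a) v w) && look (jeval (cfst a) w y)) (iota 0 s),
        (cfst c == 5) &&
          (if lhd v == 0 then look (jeval (cfst a) (ltl v) y)
           else has (fun u => look (jeval c (lcons (lhd v).-1 (ltl v)) u) &&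
             look (jeval (csnd a) (lcons (lhd v).-1 (lcons u (ltl v))) y))
             (iota 0 s))
      | (cfst c == 6) && (look (jeval a (lcons y v) 0) &&
          all (fun i => has (fun k => look (jeval a (lcons i v) k.+1))
             (iota 0 s)) (iota 0 y))]
  else if c == 0 then y == 0
  (* [cpair] is not onto: the first test makes [y] the code of a list *)
  else [&& y == lcons (lhd y) (ltl y), look (jeval (lhd c) v (lhd y)) &
         look (jargs (ltl c) v (ltl y))].

(** The digits of [table B s] are the judgements derived within [s] rounds. The round from s' to s'
    + 1 admits only judgements numbered at most s' and queries below s', so each table is a finite
    object. *)
Fixpoint table (B : nat -> bool) (s : nat) : nat :=
  if s is s'.+1 then tab s'.+1 (step B s' (bit^~ (table B s'))) else 0.

(** Program [e] with oracle [B] is seen by stage [s] to halt on [x] with output [y]. The stage also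
    bounds the use of the oracle. *)
Definition Phi e B s x y := bit (jeval e (encs [:: x]) y) (table B s).

Lemma bit_table B s j : bit j (table B s.+1) =
  (j <= s) && step B s (bit^~ (table B s)) j.
Proof. by rewrite /= bit_tab ltnS. Qed.

Lemma bit0n j : bit j 0 = false.
Proof. by rewrite -(tab0 (fun _ => false)) bit_tab. Qed.

Lemma sub_has_iota (P Q : nat -> bool) s s' :
  s <= s' -> (forall i, P i -> Q i) -> has P (iota 0 s) -> has Q (iota 0 s').
Proof.
move=> ss' PQ /hasP[i]; rewrite mem_iota => /= lt /PQ Qi.
by apply/hasP; exists i => //; rewrite mem_iota /= (leq_trans lt).
Qed.

(** [look] occurs only positively in [step], and [s] only as an upper bound. *)
Lemma step_mono B s s' (look look' : nat -> bool) j :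
  s <= s' -> (forall i, look i -> look' i) -> step B s look j -> step B s' look' j.
Proof.
move=> ss' ll'; rewrite /step; case: ifP => _.
  case/or4P => [->//|->|->|/or4P[]]; rewrite ?orbT//.
  - by case/and3P => -> lt ->; rewrite (leq_trans lt ss') !orbT.
  - case/andP => -> H; rewrite (sub_has_iota ss' _ H) ?orbT//.
    by move=> i /andP[/ll' -> /ll' ->].
  - case/andP => c5 H; apply/or4P; apply: Or44; apply/or4P; apply: Or43.
    rewrite c5; move: H; case: ifP => _; first exact: ll'.
    by apply: sub_has_iota => // i /andP[/ll' -> /ll' ->].
  - case/and3P => c6 l6 H; apply/or4P; apply: Or44; apply/or4P; apply: Or44.
    rewrite c6 (ll' _ l6); apply: sub_all H => i.
    by apply: sub_has_iota => // k; apply: ll'.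
by case: ifP => // _ /and3P[-> /ll' -> /ll' ->].
Qed.

Lemma table_mono B s s' j : s <= s' -> bit j (table B s) -> bit j (table B s').
Proof.
move=> /subnK <-; move: (s' - s) => n; elim: n => // n IH /IH {IH}.
rewrite addSn; move: (n + s) => {n}s.
elim: s j => [|s IH] j; first by rewrite bit0n.
rewrite !bit_table => /andP[js]; rewrite (leqW js) /=.
by apply: step_mono => // i; exact: IH.
Qed.

Lemma table_use B B' s : (forall i, i < s -> B i = B' i) -> table B s = table B' s.
Proof.
elim: s => // s IH BB' /=; rewrite IH => [|i lt]; last by apply: BB'; apply: leqW.
apply: eq_tab => j _; rewrite /step; case: ifP => // _.
congr [|| _, _, _ , _ | _]; case: ltnP => // lt.
by rewrite BB' // leqW.
Qed.

Lemma Phi_use e B B' s x y :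
  (forall i, i < s -> B i = B' i) -> Phi e B s x y = Phi e B' s x y.
Proof. by rewrite /Phi => /table_use ->. Qed.

Lemma Phi_mono e B s s' x y : s <= s' -> Phi e B s x y -> Phi e B s' x y.
Proof. exact: table_mono. Qed.

Lemma eval_Rec0 B f g v y : head 0 v = 0 -> eval B f (behead v) y ->
  eval B (Rec f g) v y.
Proof. by move=> v0 fy; exists (fun=> y); rewrite v0; split. Qed.

Lemma eval_RecS B f g i v u y : eval B (Rec f g) (i :: v) u ->
  eval B g [:: i, u & v] y -> eval B (Rec f g) (i.+1 :: v) y.
Proof.
move=> [s /= [s0 sS us]] gy.
exists (fun k => if k <= i then s k else y); rewrite /= ltnn; split=> //.
move=> k; rewrite ltnS => ki; rewrite ki.
by case: (ltngtP k i) ki => // [lt|->] _; [exact: sS|rewrite -us].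
Qed.

Lemma step_Zero B s look v y :
  step B s look (jeval (enc Zero) (encs v) y) = (y == 0).
Proof. by rewrite /step !jevalE -[enc Zero]/(cpair 0 0) !cpairE /= orbF. Qed.

Lemma step_Succ B s look v y :
  step B s look (jeval (enc Succ) (encs v) y) = (y == (head 0 v).+1).
Proof.
by rewrite /step !jevalE -[enc Succ]/(cpair 1 0)
  !cpairE lhd_encs /= orbF.
Qed.

Lemma step_Proj B s look i v y :
  step B s look (jeval (enc (Proj i)) (encs v) y) = (y == nth 0 v i).
Proof.
by rewrite /step !jevalE -[enc (Proj i)]/(cpair 2 i)
  !cpairE lnth_encs /= orbF.
Qed.

Lemma step_Oracle B s look v y :
  step B s look (jeval (enc Oracle) (encs v) y) =
  (head 0 v < s) && (y == B (head 0 v)).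
Proof.
by rewrite /step !jevalE -[enc Oracle]/(cpair 3 0)
  !cpairE lhd_encs /= orbF.
Qed.

Lemma step_Comp B s look f gs v y :
  step B s look (jeval (enc (Comp f gs)) (encs v) y) =
  has (fun w => look (jargs (encs (map enc gs)) (encs v) w) &&
                look (jeval (enc f) w y)) (iota 0 s).
Proof. by rewrite /step !jevalE (enc_Comp f gs) !cpairE /= orbF. Qed.

Lemma step_Rec B s look f g v y :
  step B s look (jeval (enc (Rec f g)) (encs v) y) =
  if head 0 v == 0 then look (jeval (enc f) (encs (behead v)) y)
  else has (fun u =>
    look (jeval (enc (Rec f g)) (encs ((head 0 v).-1 :: behead v)) u) &&
    look (jeval (enc g) (encs [:: (head 0 v).-1, u & behead v]) y)) (iota 0 s).
Proof.
have -> : enc (Rec f g) = cpair 5 (cpair (enc f) (enc g)) by [].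
by rewrite /step !jevalE !cpairE lhd_encs ltl_encs /= orbF.
Qed.

Lemma step_Mu B s look f v y :
  step B s look (jeval (enc (Mu f)) (encs v) y) =
  look (jeval (enc f) (encs (y :: v)) 0) &&
  all (fun i => has (fun k => look (jeval (enc f) (encs (i :: v)) k.+1))
    (iota 0 s)) (iota 0 y).
Proof. by rewrite /step !jevalE -[enc (Mu f)]/(cpair 6 (enc f)) !cpairE /=. Qed.

Lemma step_nil B s look v w : step B s look (jargs (encs [::]) v w) = (w == 0).
Proof. by rewrite /step !jargsE /=. Qed.

Lemma step_cons B s look g gs v w :
  step B s look (jargs (encs (g :: gs)) v w) =
  [&& w == lcons (lhd w) (ltl w), look (jeval g v (lhd w)) &
      look (jargs (encs gs) v (ltl w))].
Proof.
rewrite /step !jargsE lhd_encs ltl_encs /=; congr (if _ then _ else _).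
Qed.

(** Both kinds of judgement are treated in one induction on the stage, since each refers to the
    other at earlier stages. *)
Lemma table_sound (B : set nat) s :
  (forall c v y, bit (jeval (enc c) (encs v) y) (table (fun i => i \in B) s) ->
    eval B c v y) /\
  (forall gs v w,
    bit (jargs (encs (map enc gs)) (encs v) w) (table (fun i => i \in B) s) ->
    exists2 w', w = encs w' & pointwise (fun g z => eval B g v z) gs w').
Proof.
elim: s => [|s [IHe IHa]]; first by split=> ? ? ?; rewrite bit0n.
split=> [c v y|gs v w]; rewrite bit_table => /andP[_].
  case: c => [||i||f gs|f g|f].
  - by rewrite step_Zero => /eqP.
  - by rewrite step_Succ => /eqP.
  - by rewrite step_Proj => /eqP.
  - by rewrite step_Oracle => /andP[_ /eqP].
  - rewrite step_Comp => /hasP[w _ /andP[/IHa[w' -> gsw'] /IHe fy]].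
    by exists w'.
  - rewrite step_Rec; case: eqP => [v0 /IHe|].
      exact: eval_Rec0.
    case: v => [//|[//|x] v] _ /hasP[u _ /andP[/IHe H1 /IHe H2]].
    exact: eval_RecS H1 H2.
  - rewrite step_Mu => /andP[/IHe H1 /allP H2]; split=> // i lt.
    have /H2/hasP[k _ /IHe H3] : i \in iota 0 y by rewrite mem_iota.
    by exists k.
case: gs => [|g gs]; first by rewrite step_nil => /eqP ->; exists [::].
rewrite [map _ _]/= step_cons => /and3P[/eqP wE /IHe gw /IHa[w' w'E gsw']].
by exists (lhd w :: w'); rewrite //= -w'E.
Qed.

(** A derivable judgement enters the table only once the stage also exceeds its own number. *)
Lemma table_intro B s j : step B s (bit^~ (table B s)) j ->
  exists s', bit j (table B s').
Proof.
move=> H; exists (maxn s j).+1; rewrite bit_table leq_maxr /=.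
apply: step_mono H; first exact: leq_maxl.
by move=> i; apply: table_mono; exact: leq_maxl.
Qed.

Lemma bounded_stages (Q : nat -> nat -> Prop) n :
  (forall i s s', s <= s' -> Q i s -> Q i s') ->
  (forall i, i < n -> exists s, Q i s) -> exists s, forall i, i < n -> Q i s.
Proof.
move=> mono; elim: n => [|n IH] H; first by exists 0.
have [|s Hs] := IH; first by move=> i lt; apply: H; apply: leqW.
have [s' Hs'] := H n (ltnSn n); exists (maxn s s') => i.
rewrite ltnS leq_eqVlt => /predU1P[->|/Hs]; apply: mono.
- exact: leq_maxr.
- exact: Hs'.
- exact: leq_maxl.
Qed.

Lemma has_iota (P : nat -> bool) i s : i < s -> P i -> has P (iota 0 s).
Proof. by move=> lt Pi; apply/hasP; exists i => //; rewrite mem_iota. Qed.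

(** By induction on the program: past the maximum of the stages of the finitely many premises and of
    the bounds on the intermediate values, one further step applies. *)
Lemma table_complete (B : set nat) c v y : eval B c v y ->
  exists s, bit (jeval (enc c) (encs v) y) (table (fun i => i \in B) s).
Proof.
have := @table_intro (fun i => i \in B); have := @table_mono (fun i => i \in B).
set T := table _ => mono intro.
elim/code_nested_ind: c v y => [||i||f gs IHf IHgs|f g IHf IHg|f IHf] v y.
- by move=> -> ; apply: (intro 0); rewrite step_Zero.
- by move=> ->; apply: (intro 0); rewrite step_Succ.
- by move=> ->; apply: (intro 0); rewrite step_Proj.
- move=> ->; apply: (intro (head 0 v).+1).
  by rewrite step_Oracle ltnSn eqxx.
- move=> [w gsw /IHf[s1 H1]].
  have [s2 H2] : exists s, bit (jargs (encs (map enc gs)) (encs v) (encs w)) (T s).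
    elim: IHgs w gsw {IHf s1 H1} => [|g gs' IHg _ IH] [|z w] //.
      by move=> _; apply: (intro 0); rewrite step_nil.
    move=> [/IHg[s1 H1] /IH[s2 H2]].
    apply: (intro (maxn s1 s2)); rewrite [map _ _]/= step_cons.
    rewrite lhd_encs ltl_encs; apply/and3P; split=> //.
      exact: mono (leq_maxl _ _) H1.
    exact: mono (leq_maxr _ _) H2.
  apply: (intro (maxn (maxn s1 s2) (encs w).+1)).
  rewrite step_Comp; apply: (has_iota (i := encs w)); first exact: leq_maxr.
  apply/andP; split.
    by apply: mono H2; rewrite -maxnA maxnCA leq_maxl.
  by apply: mono H1; rewrite -maxnA leq_maxl.
- move=> [sq [/IHf[s0 H0] sqS ->]].
  have start u : head 0 u = 0 -> behead u = behead v ->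
      exists s, bit (jeval (enc (Rec f g)) (encs u) (sq 0)) (T s).
    by move=> u0 uv; apply: (intro s0); rewrite step_Rec u0 uv.
  have H i : i <= head 0 v ->
      exists s, bit (jeval (enc (Rec f g)) (encs (i :: behead v)) (sq i)) (T s).
    elim: i => [|i IH] lt; first exact: start.
    have [s1 H1] := IH (ltnW lt); have [s2 H2] := IHg _ _ (sqS _ lt).
    apply: (intro (maxn (maxn s1 s2) (sq i).+1)).
    rewrite step_Rec; apply: (has_iota (i := sq i)); first exact: leq_maxr.
    apply/andP; split.
      by apply: mono H1; rewrite -maxnA leq_maxl.
    by apply: mono H2; rewrite -maxnA maxnCA leq_maxl.
  by case: v start H {sqS H0} => [start _|x v _ /(_ x)]; [exact: start|exact].
- move=> [/IHf[s0 H0] fS].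
  have [s1 H1] : exists s, forall i, i < y ->
      exists2 k, k < s & bit (jeval (enc f) (encs (i :: v)) k.+1) (T s).
    apply: bounded_stages.
      move=> i s s' ss' [k ks H]; exists k; first exact: leq_trans ss'.
      exact: mono H.
    move=> i /fS[k /IHf[s H]]; exists (maxn k.+1 s), k; first exact: leq_maxl.
    by apply: mono H; exact: leq_maxr.
  apply: (intro (maxn s0 s1)); rewrite step_Mu; apply/andP; split.
    exact: mono (leq_maxl _ _) H0.
  apply/allP => i; rewrite mem_iota => /andP[_] /H1[k ks Hk].
  apply: (has_iota (i := k)); first by rewrite leq_max ks orbT.
  exact: mono (leq_maxr _ _) Hk.
Qed.

Lemma Phi_sound (B : set nat) c s x y :
  Phi (enc c) (fun i => i \in B) s x y -> eval B c [:: x] y.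
Proof. by have [H _] := table_sound B s; exact: H. Qed.

Lemma Phi_complete (B : set nat) c x y : eval B c [:: x] y ->
  exists s, Phi (enc c) (fun i => i \in B) s x y.
Proof. exact: table_complete. Qed.

Lemma computable_from_Phi (B : set nat) g : computable_from B g ->
  exists e, (forall x, exists s, Phi e (fun i => i \in B) s x (g x)) /\
    (forall x s y, Phi e (fun i => i \in B) s x y -> y = g x).
Proof.
move=> [c Hc]; exists (enc c); split=> [x|x s y /Phi_sound].
  by apply: Phi_complete; apply/Hc.
by move/Hc => /= [].
Qed.

Lemma computable_Phi (h : (nat -> bool) -> nat -> bool) : computable h ->
  exists e, (forall Z x, h Z x -> exists s, Phi e Z s x 1) /\
    (forall Z x s, Phi e Z s x 1 -> h Z x).
Proof.
move=> [c Hc]; exists (enc c).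
have ZE (Z : nat -> bool) s i : i < s -> Z i = (i \in [set i | Z i]).
  by move=> _; apply/esym/(asboolb (Z _)).
split=> [Z x hx|Z x s].
  have := Hc Z [:: x]; rewrite /= hx => /Phi_complete[s H].
  by exists s; rewrite (Phi_use _ _ _ (ZE Z s)).
rewrite (Phi_use _ _ _ (ZE Z s)) => /Phi_sound H.
by have := eval_fun H (Hc Z [:: x]); case: (h _ _).
Qed.

Lemma computable_iter_ltl a b : computable a -> computable b ->
  computable (fun Z x => iter (a Z x) ltl (b Z x)).
Proof.
by move=> Ha Hb; apply: computable_iter => //; apply/computable_ltl/computable_id.
Qed.

Lemma computable_step (r s t j : (nat -> bool) -> nat -> nat) :
  computable r -> computable s -> computable t -> computable j ->
  computable (fun Z u => step (bit^~ (r Z u)) (s Z u) (bit^~ (t Z u)) (j Z u)).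
Proof.
move=> Hr Hs Ht Hj.
suff H : computable (fun _ u =>
    step (bit^~ (cfst u)) (cfst (csnd u)) (bit^~ (cfst (csnd (csnd u))))
      (csnd (csnd (csnd u)))).
  have Hu := computable_cpair Hr (computable_cpair Hs (computable_cpair Ht Hj)).
  by apply: computable_ext (computable_comp H Hu) => Z x; rewrite !cpairE.
rewrite /step.
rewrite /jeval /jargs /lhd /lcons.
repeat first [ computable_subterms
  | match goal with
    | |- computable (fun Z x => iter (@?a Z x) ltl (@?b Z x)) =>
        apply: (computable_iter_ltl (a := a) (b := b))
    | |- computable (fun Z x => ltl (@?a Z x)) =>
        apply: (computable_ltl (a := a))
    end ].
Qed.

(** With the oracle given by the digits of a number, evaluation by stages is computable in all its
    arguments, the program included. This takes the place of a universal machine. *)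
Lemma computable_Phi_bit (e r s x y : (nat -> bool) -> nat -> nat) :
  computable e -> computable r -> computable s -> computable x -> computable y ->
  computable (fun Z u =>
    Phi (e Z u) (bit^~ (r Z u)) (s Z u) (x Z u) (y Z u)).
Proof.
move=> He Hr Hs Hx Hy; apply: computable_bit.
  by rewrite /jeval /= /lcons; prove_computable.
suff H : computable (fun Z u => iteri (s Z u)
    (fun i T => tab i.+1 (step (bit^~ (r Z u)) i (bit^~ T))) 0).
  by apply: computable_ext H => Z u; elim: (s Z u) => //= n ->.
apply: (@computable_iteri (fun Z u i T =>
  tab i.+1 (step (bit^~ (r Z u)) i (bit^~ T)))) => //; first exact: computable_const.
apply: computable_tab; first by prove_computable.
apply: computable_step; try by prove_computable.
apply: (computable_comp Hr); by prove_computable.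
Qed.

(** * A diagonalizing function, and compactness *)

(** The empty oracle answers 0 to every query, so [Zero] can replace [Oracle]; this yields the
    oracle-free programs that [partial_computable] asks for. *)
Fixpoint strip c :=
  match c with
  | Zero => Zero
  | Succ => Succ
  | Proj i => Proj i
  | Oracle => Zero
  | Comp f gs => Comp (strip f) (map strip gs)
  | Rec f g => Rec (strip f) (strip g)
  | Mu f => Mu (strip f)
  end.

Lemma oracle_free_strip c : oracle_free (strip c).
Proof.
elim/code_nested_ind: c => //=.
  by move=> f gs -> IH /=; elim: IH => //= g gs' -> _ ->.
by move=> f g -> ->.
Qed.

Lemma eval_strip c v y : eval set0 (strip c) v y <-> eval set0 c v y.
Proof.
elim/code_nested_ind: c v y => //=.
- by move=> v y; rewrite in_set0.
- move=> f gs IHf IHgs v y.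
  have E w : pointwise (fun g z => eval set0 g v z) (map strip gs) w <->
      pointwise (fun g z => eval set0 g v z) gs w.
    elim: IHgs w => [|g gs' IHg _ IH] [|z w] //=.
    by split=> -[/IHg ? /IH ?].
  by split=> -[w /E ? /IHf ?]; exists w.
- move=> f g IHf IHg v y.
  by split=> -[s [/IHf ? H ?]]; exists s; split=> // i /H /IHg.
- move=> f IHf v y.
  by split=> -[/IHf ? H]; split=> // i /H[k /IHf ?]; exists k.
Qed.

Lemma set_of_false : [set i : nat | false] = set0.
Proof. by apply/seteqP; split. Qed.

Definition ce (P : nat -> Prop) := exists R : nat -> nat -> bool,
  computable (fun _ u => R (cfst u) (csnd u)) /\
  forall x, P x <-> exists w, R x w.

(** Applied to the set of valuations that are impossible for every configuration: if [f] itself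
    realizes one of them, an actual configuration refutes it, so on the inputs (c, j) every
    valuation p is possible. *)
Definition diagonalizes (f : nat -> option bool) := forall P, ce P -> exists c,
  (exists2 p, P (cpair c p) & forall j, f (cpair c j) = Some (bit j p)) \/
  (forall p, ~ P (cpair c p)).

(* [f] copies, on the inputs [(c, j)], the bits of the first number [p] such
   that [(c, p)] is found to lie in the [c]-th c.e. set: the code is handed its
   own index, so that [P] may refer to the inputs on which it controls [f]. *)
Lemma diagonal_function : exists2 f, partial_computable f & diagonalizes f.
Proof.
(* [t] codes a triple (p, (w, s)): by stage s the program c has accepted the pair ((c, p), w). *)
pose Q c t := Phi c (bit^~ 0) (csnd (csnd t))
  (cpair (cpair c (cfst t)) (cfst (csnd t))) 1.
pose f x := if pselect (exists t, Q (cfst x) t) is left H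
  then Some (bit (csnd x) (cfst (ex_minn H))) else None.
exists f; last first.
  move=> P [R [HR PR]].
  have [c [Hc1 Hc2]] := computable_Phi HR; exists c.
  have B0 : (bit^~ 0) = (fun=> false) by apply/funext => i; exact: bit0n.
  have QP t : Q c t -> P (cpair c (cfst t)).
    by move/Hc2; rewrite !cpairE => Rw; apply/PR; exists (cfst (csnd t)).
  have PQ p : P (cpair c p) -> exists t, Q c t.
    move=> /PR[w Rw].
    have /(Hc1 (bit^~ 0))[s Hs] : R (cfst (cpair (cpair c p) w))
      (csnd (cpair (cpair c p) w)) by rewrite !cpairE.
    by exists (cpair p (cpair w s)); rewrite /Q !cpairE.
  case: (pselect (exists t, Q c t)) => H; last first.
    by right=> p /PQ.
  left; case: (ex_minnP H) => t Qt tmin.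
  exists (cfst t); first exact: QP.
  move=> j; rewrite /f !cpairE; case: pselect => [H'|[]//].
  case: (ex_minnP H') => t' Qt' t'min; congr (Some (bit _ (cfst _))).
  by apply/eqP; rewrite eqn_leq t'min// tmin.
(* [d] vanishes where [Q] holds, so [Mu d] finds the least [t], from which [g] reads off the
   required digit of p. *)
have [d Hd] : computableL (fun _ v => ~~ Q (cfst (nth 0 v 1)) (nth 0 v 0)).
  have HQ : computable (fun _ u => ~~ Q (cfst u) (csnd u)).
    apply: computable_neg; apply: computable_Phi_bit; by prove_computable.
  have P1 := computableL_proj 1; have P0 := computableL_proj 0.
  have C := computableL_comp1 (computable_cfst computable_id) P1.
  apply: computableL_ext (computableL_comp1 HQ (computableL_cpair C P0)) => Z v.
  by rewrite /= !cpairE.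
have [g Hg] : computableL (fun _ v => bit (csnd (nth 0 v 1)) (cfst (nth 0 v 0))).
  have HQ : computable (fun _ u => bit (csnd (csnd u)) (cfst (cfst u))).
    by prove_computable.
  have P1 := computableL_proj 1; have P0 := computableL_proj 0.
  apply: computableL_ext (computableL_comp1 HQ (computableL_cpair P0 P1)) => Z v.
  by rewrite /= !cpairE.
exists (strip (Comp g [:: Mu d; Proj 0])); first exact: oracle_free_strip.
have {}Hd t x : eval set0 d [:: t; x] (~~ Q (cfst x) t).
  by have := Hd (fun=> false) [:: t; x]; rewrite set_of_false.
have {}Hg t x : eval set0 g [:: t; x] (bit (csnd x) (cfst t)).
  by have := Hg (fun=> false) [:: t; x]; rewrite set_of_false.
move=> x y; split=> [/eval_strip /=|].
  move=> [[|t [|x' [|? ?]]]] /=; [by []|by case| |by case=> _ []].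
  move=> [[dt dlt] [-> _]] gy.
  have Qt : Q (cfst x) t by have := eval_fun (Hd t x) dt; case: (Q _ _).
  rewrite /f; case: pselect => [H|[]]; last by exists t.
  case: ex_minnP => t' Qt' t'min /=; have tt' : t' = t.
    apply/eqP; rewrite eqn_leq t'min//= leqNgt; apply/negP => /dlt[k dk].
    by have := eval_fun (Hd t' x) dk; rewrite Qt'.
  by rewrite tt'; congr Some; exact: eval_fun (Hg t x) gy.
rewrite /f; case: pselect => // H [<-].
apply: (proj2 (eval_strip (Comp g [:: Mu d; Proj 0]) _ _)).
case: ex_minnP => t Qt tmin; exists [:: t; x] => //; split; last by [].
split; first by have := Hd t x; rewrite Qt.
move=> i it; exists 0; have := Hd i x; case QE: Q => //.
by move: (tmin _ QE); rewrite leqNgt it.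
Qed.

(** König's lemma for finite levels in which each element has a parent: the path runs through
    elements with descendants at every depth. *)
Lemma konig (T : eqType) (Lam : nat -> seq T) (r : nat -> T -> T -> Prop) :
  (forall n, Lam n != [::]) ->
  (forall n t', t' \in Lam n.+1 -> exists2 t, t \in Lam n & r n t t') ->
  exists c : nat -> T, forall n, c n \in Lam n /\ r n (c n) (c n.+1).
Proof.
move=> Lam0 par.
(* [desc k i t]: from [t] in level i a chain descends through k further levels. *)
pose desc := fix desc k i t : Prop := if k is k'.+1
  then t \in Lam i /\ (exists t', r i t t' /\ desc k' i.+1 t') else t \in Lam i.
have descL k i t : desc k i t -> t \in Lam i by case: k => //= k [].
have descS k i t : desc k.+1 i t -> desc k i t.
  elim: k i t => [|k IH] i t; first by case.
  by move=> [tL [t' [rt /IH H]]]; split=> //; exists t'.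
have desc_le k k' i t : k <= k' -> desc k' i t -> desc k i t.
  by move=> /subnK <-; elim: (k' - k) => //= n IH /descS.
have root k i t : desc k i t -> exists t0, desc (i + k) 0 t0.
  elim: i k t => [|i IH] k t H; first by exists t.
  have [t0 t0L rt] := par _ _ (descL _ _ _ H).
  by rewrite addSnnS; apply: (IH k.+1 t0); split=> //; exists t.
(* Otherwise, level 0 being finite, some N bounds the depth below all its elements, yet an element
   of level N has an ancestor in level 0. *)
have [t0 Ht0] : exists t, forall k, desc k 0 t.
  apply: contrapT => H.
  have [N HN] : exists N, forall t, t \in Lam 0 -> ~ desc N 0 t.
    elim: (Lam 0) => [|t L [N HN]]; first by exists 0.
    have [k Hk] : exists k, ~ desc k 0 t.
      by apply/existsNP => Ht; apply: H; exists t.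
    exists (maxn N k) => u; rewrite inE => /predU1P[->|/HN uN].
      by move=> /(desc_le _ _ _ _ (leq_maxr N k)).
    by move=> /(desc_le _ _ _ _ (leq_maxl N k)).
  case E : (Lam N) (Lam0 N) => [//|t L] _.
  have [u Hu] : exists t0, desc (N + 0) 0 t0.
    by apply: (root 0 N t); rewrite /= E mem_head.
  by rewrite addn0 in Hu; exact: HN (descL _ _ _ Hu) Hu.
have next i t : (forall k, desc k i t) ->
    exists t', r i t t' /\ forall k, desc k i.+1 t'.
  move=> Ht; apply: contrapT => H.
  have [N HN] : exists N, forall t', t' \in Lam i.+1 -> r i t t' ->
      ~ desc N i.+1 t'.
    elim: (Lam i.+1) => [|u L [N HN]]; first by exists 0.
    have [k Hk] : exists k, ~ (r i t u /\ desc k i.+1 u).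
      apply/existsNP => Hu; apply: H; exists u; split.
        by have [] := Hu 0.
      by move=> k; have [] := Hu k.
    exists (maxn N k) => v; rewrite inE => /predU1P[->|/HN vN] rv.
      by move=> /(desc_le _ _ _ _ (leq_maxr N k)) Hd; apply: Hk.
    by move=> /(desc_le _ _ _ _ (leq_maxl N k)); exact: vN.
  have [_ [t' [rt dt']]] := Ht N.+1.
  exact: HN (descL _ _ _ dt') rt dt'.
pose S := {p : nat * T | forall k, desc k p.1 p.2}.
have nextS (p : S) : {q : S | (sval q).1 = (sval p).1.+1 /\
    r (sval p).1 (sval p).2 (sval q).2}.
  apply: cid; have [t' [rt Ht']] := next _ _ (svalP p).
  by exists (exist (fun p : nat * T => forall k, desc k p.1 p.2)
    ((sval p).1.+1, t') Ht').
pose F := fix F n : S := if n is n'.+1 then sval (nextS (F n'))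
  else exist (fun p : nat * T => forall k, desc k p.1 p.2) (0, t0) Ht0.
have F1 n : (sval (F n)).1 = n.
  by elim: n => //= n IH; have [-> _] := svalP (nextS (F n)); rewrite IH.
exists (fun n => (sval (F n)).2) => n; split.
  by have := svalP (F n) 0; rewrite F1; exact: descL.
have [_] := svalP (nextS (F n)); rewrite -[sval (nextS _)]/(F n.+1).
by rewrite F1.
Qed.

(** Compactness of Cantor space: König's lemma applies to the strings of length n that begin some
    [z] with [K s' z] and s' >= n. *)
Lemma cantor_compact (K : nat -> nat -> Prop) : (forall s, exists z, K s z) ->
  exists Z : nat -> bool, forall s, exists s' z,
    [/\ s <= s', K s' z & forall i, i < s -> Z i = bit i z].
Proof.
move=> HK.
pose ext n z := exists s' z', [/\ n <= s', K s' z' &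
  forall i, i < n -> bit i z = bit i z'].
have tab_ext n z : ext n z -> ext n (tab n (bit^~ z)).
  move=> [s' [z' [ns' Kz' zz']]]; exists s', z'; split=> // i lt.
  by rewrite bit_tab lt zz'.
have [||c Hc] := @konig nat (fun n => [seq z <- iota 0 (2 ^ n) | `[< ext n z >]])
  (fun n z z' => forall i, i < n -> bit i z = bit i z').
- move=> n; have [z Kz] := HK n.
  have Hz : ext n (tab n (bit^~ z)) by apply: tab_ext; exists n, z.
  rewrite -has_filter; apply/hasP; exists (tab n (bit^~ z)).
    by rewrite mem_iota tab_lt.
  exact/asboolP.
- move=> n z; rewrite mem_filter => /andP[/asboolP Hz _].
  have {}Hz : ext n z.
    have [s' [z' [ns' Kz' zz']]] := Hz; exists s', z'; split=> //.
      exact: ltnW.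
    by move=> i lt; apply: zz'; exact: ltnW.
  exists (tab n (bit^~ z)).
    rewrite mem_filter mem_iota /= tab_lt andbT.
    by apply/asboolP; exact: tab_ext.
  by move=> i lt; rewrite bit_tab lt.
exists (fun i => bit i (c i.+1)) => s.
have [] := Hc s; rewrite mem_filter => /andP[/asboolP[s' [z [ss' Kz zz']]] _] _.
exists s', z; split=> // i lt; rewrite -zz'//.
elim: s lt {ss' Kz zz'} => // s IH; rewrite ltnS leq_eqVlt => /predU1P[->//|lt].
by rewrite IH//; have [_] := Hc s; apply.
Qed.

(** By compactness, if every oracle has a witness then a single stage s bounds the witnesses and
    uses for all oracles, and only the 2^s initial segments of length s must be checked. *)
Lemma ce_forall_oracle (h : (nat -> bool) -> nat -> bool) : computable h ->
  ce (fun x => forall Z, exists w, h Z (cpair x w)).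
Proof.
move=> Hh; have [e [He1 He2]] := computable_Phi Hh.
exists (fun x s => all (fun z => has (fun w =>
  Phi e (bit^~ z) s (cpair x w) 1) (iota 0 s.+1)) (iota 0 (2 ^ s))); split.
  prove_computable.
  by apply: computable_Phi_bit; prove_computable.
move=> x; split=> [H|[s /allP Hs] Z].
  apply: contrapT => /forallNP H'.
  have [|Z HZ] := @cantor_compact (fun s z => forall w, w <= s ->
      ~~ Phi e (bit^~ z) s (cpair x w) 1).
    move=> s; have /negP := H' s; rewrite -has_predC => /hasP[z _ /hasPn Hz].
    by exists z => w ws; apply: (Hz w); rewrite mem_iota.
  have [w /He1[s Hs]] := H Z.
  have [s' [z [ss' Hz Zz]]] := HZ (maxn s w).
  have := Hz w (leq_trans (leq_maxr _ _) ss').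
  apply/negP; rewrite negbK.
  apply: Phi_mono (leq_trans (leq_maxl _ _) ss') _.
  rewrite -(@Phi_use _ Z)// => i lt; apply: Zz.
  exact: leq_trans lt (leq_maxl _ _).
have /Hs/hasP[w _ Hw] : tab s Z \in iota 0 (2 ^ s) by rewrite mem_iota tab_lt.
exists w; apply: (He2 _ _ s); rewrite (@Phi_use _ Z (bit^~ (tab s Z)))//.
by move=> i lt; rewrite bit_tab lt.
Qed.

(** * Conditions and their splitting *)

(** Effectively open conditions on [Z]; the closed properties shared by configurations are negations
    of such conditions. *)
Definition semidecidable (O : (nat -> bool) -> nat -> Prop) :=
  exists2 h : (nat -> bool) -> nat -> bool, computable h &
    forall Z x, O Z x <-> exists w, h Z (cpair x w).

Lemma semidecidable_ext O O' : (forall Z x, O Z x <-> O' Z x) ->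
  semidecidable O -> semidecidable O'.
Proof.
move=> OO' [h Hh HO]; exists h => // Z x.
exact: iff_trans (iff_sym (OO' Z x)) (HO Z x).
Qed.

Lemma semidecidable_False : semidecidable (fun _ _ => False).
Proof.
exists (fun _ _ => false); first exact: (computable_const 0).
by move=> Z x; split=> // -[].
Qed.

Lemma semidecidable_or O O' : semidecidable O -> semidecidable O' ->
  semidecidable (fun Z x => O Z x \/ O' Z x).
Proof.
move=> [h Hh HO] [h' Hh' HO']; exists (fun Z u => h Z u || h' Z u).
  exact: computable_or.
move=> Z x; split.
  by case=> [/HO|/HO'] [w hw]; exists w; rewrite hw ?orbT.
by move=> [w /orP[hw|hw]]; [left; apply/HO|right; apply/HO']; exists w.
Qed.

Lemma semidecidable_exists (h : (nat -> bool) -> nat -> bool) : computable h ->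
  semidecidable (fun Z _ => exists w, h Z w).
Proof.
move=> Hh; exists (fun Z u => h Z (csnd u)).
  exact: computable_comp Hh (computable_csnd computable_id).
by move=> Z x; split=> -[w hw]; exists w; move: hw; rewrite csnd_cpair.
Qed.

Lemma semidecidable_exists_in (T : eqType) (s : seq T)
    (O : T -> (nat -> bool) -> nat -> Prop) :
  (forall t, t \in s -> semidecidable (O t)) ->
  semidecidable (fun Z x => exists2 t, t \in s & O t Z x).
Proof.
elim: s => [_|t s IH H].
  by apply: semidecidable_ext semidecidable_False => Z x; split=> // -[].
have Ht := H t (mem_head _ _).
have {}IH : semidecidable (fun Z x => exists2 t, t \in s & O t Z x).
  by apply: IH => u us; apply: H; rewrite inE us orbT.
apply: semidecidable_ext (semidecidable_or Ht IH) => Z x; split.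
  case=> [Ot|[u us Ou]]; first by exists t => //; exact: mem_head.
  by exists u => //; rewrite inE us orbT.
move=> [u]; rewrite inE => /predU1P[->|us] Ou; first by left.
by right; exists u.
Qed.

(** The oracles compatible with a Mathias condition: [F] decides membership below [l], and further
    elements come from [V]. *)
Definition cone (F l : nat) (V B : nat -> bool) :=
  (forall x, x < l -> B x = bit x F) /\ (forall x, l <= x -> B x -> V x).

(** A halting computation sees only a finite part of [B], so the search over sets becomes a search
    over numbers r coding finite sets. *)
Lemma semidecidable_cone F l e (S : (nat -> bool) -> nat -> bool)
    (Q : nat -> nat -> nat -> bool) : computable S ->
  computable (fun _ u => Q (cfst u) (cfst (csnd u)) (csnd (csnd u))) ->
  semidecidable (fun Z x => exists B s n y,
    [/\ cone F l (S Z) B, Phi e B s n y & Q x n y]).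
Proof.
move=> HS HQ.
pose h Z u := let x := cfst u in let r := cfst (csnd u) in
  let s := cfst (csnd (csnd u)) in
  let n := cfst (csnd (csnd (csnd u))) in let y := csnd (csnd (csnd (csnd u))) in
  [&& all (fun i => bit i r == bit i F :> nat) (iota 0 l),
      all (fun i => (l <= i) && bit i r ==> S Z i) (iota 0 s),
      Phi e (bit^~ r) s n y & Q x n y].
exists h.
  rewrite /h; prove_computable.
  - apply: (computable_comp HS); prove_computable.
  - apply: computable_Phi_bit; prove_computable.
  - have H : computable (fun (_ : nat -> bool) u => cpair (cfst u)
        (cpair (cfst (csnd (csnd (csnd u)))) (csnd (csnd (csnd (csnd u)))))).
      by prove_computable.
    by apply: computable_ext (computable_comp HQ H) => Z x; rewrite !cpairE.
move=> Z x; split.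
  move=> [B [s [n [y [[BF BS] HB Qxny]]]]].
  (* The code must reach beyond both the prescribed part, of length l, and the use s. *)
  exists (cpair (tab (maxn l s) B) (cpair s (cpair n y))).
  rewrite /h !cpairE Qxny andbT; apply/and3P; split.
  - apply/allP => i; rewrite mem_iota add0n => /andP[_ il].
    by rewrite bit_tab leq_max il /= BF.
  - apply/allP => i _; apply/implyP => /andP[li].
    by rewrite bit_tab => /andP[_ Bi]; exact: BS.
  - rewrite -(@Phi_use _ B)// => i lt.
    by rewrite bit_tab leq_max lt orbT.
move=> [w]; rewrite /h !cpairE; set r := cfst w; set s := cfst (csnd w).
set n := cfst _; set y := csnd _ => /and4P[/allP H1 /allP H2 HB Qxny].
exists (fun i => ((i < l) || (i < s)) && bit i r), s, n, y; split=> //.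
- split=> i.
    move=> il; rewrite il; have := H1 i; rewrite mem_iota il => /(_ isT).
    by case: (bit i r) (bit i F) => -[].
  move=> li; rewrite ltnNge li /= => /andP[is' ri].
  by have := H2 i; rewrite mem_iota is' ri li => /(_ isT).
- by rewrite (@Phi_use _ _ (bit^~ r))// => i lt; rewrite lt orbT.
Qed.

(* [(F, l, cs, e)]: the finite set coded by [F], fixed below [l]; the pairs
   [(e', n)] in [cs] are the programs [e'] kept from halting on [n]; the
   programs below [e] are dealt with. *)
Definition node := (nat * nat * seq (nat * nat) * nat)%type.
Definition nF (t : node) := t.1.1.1.
Definition nl (t : node) := t.1.1.2.
Definition ncs (t : node) := t.1.2.
Definition nlev (t : node) := t.2.
Definition root_node : node := (0, 0, [::], 0).

Definition ok (t : node) (V : nat -> bool) := forall B, cone (nF t) (nl t) V B ->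
  forall e n s y, (e, n) \in ncs t -> ~~ Phi e B s n y.

(** The stage bound [l] confines the computation to [F] below [l], so the conflict persists in every
    set that agrees with [F] there. *)
Definition conflict (f : nat -> option bool) e F l := exists x y b,
  [/\ Phi e (bit^~ F) l x y, f x = Some b & y <> b].

(** A child adds at least one element, which makes the final union infinite, and settles program
    [nlev t], by a conflict with [f] or by a recorded divergence. *)
Definition child (A : nat -> bool) f (t t' : node) :=
  [/\ nl t < nl t',
      forall x, x < nl t -> bit x (nF t') = bit x (nF t),
      exists2 x, nl t <= x < nl t' & bit x (nF t'),
      forall x, nl t <= x < nl t' -> bit x (nF t') -> A x
    & nlev t' = (nlev t).+1 /\
      ((ncs t' = ncs t /\ conflict f (nlev t) (nF t') (nl t')) \/
       exists n, ncs t' = (nlev t, n) :: ncs t)].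

Definition agree l (V V' : nat -> bool) := forall x, x < l -> V x = V' x.

Lemma coneS F l (V V' B : nat -> bool) :
  (forall x, V x -> V' x) -> cone F l V B -> cone F l V' B.
Proof. by move=> VV' [BF BV]; split=> // x lx /(BV x lx)/VV'. Qed.

Lemma cone_trans F l F' l' (V V' B : nat -> bool) : l <= l' ->
  (forall x, x < l -> bit x F' = bit x F) ->
  (forall x, l <= x < l' -> bit x F' -> V' x) ->
  (forall x, V x -> V' x) -> cone F' l' V B -> cone F l V' B.
Proof.
move=> ll' F'F F'V VV' [BF BV]; split=> x.
  by move=> xl; rewrite BF ?F'F// (leq_trans xl).
move=> lx; have [xl'|l'x] := ltnP x l'; last by move=> /(BV x l'x)/VV'.
by rewrite BF// => /F'V; apply; rewrite lx.
Qed.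

Lemma okS t (V V' : nat -> bool) : (forall x, V x -> V' x) -> ok t V' -> ok t V.
Proof. by move=> VV' H B /(coneS VV'); exact: H. Qed.

(* How the piece [V] of [t] can be continued, [A] being the set of the theorem:
   it is finite on [A], or a finite extension inside [A] makes the program
   disagree with [f], or no extension inside [A] does. *)
Inductive status :=
| Dead of nat
| Conflict of node & nat
| Stuck of nat & nat.

(** In the [Conflict] case, [M] lets the extension be carried over to other pieces that agree with
    [V] below [M]. In the [Stuck] case, [F] already contains a new element, so that it can serve in
    a child. *)
Definition status_spec (A : nat -> bool) f (t : node) (V : nat -> bool) st :=
  match st with
  | Dead k => forall x, k <= x -> A x -> V x -> False
  | Conflict t' M => child A f t t' /\
      forall V', agree M V V' -> ok t V' -> ok t' V'
  | Stuck F l =>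
      [/\ [/\ nl t < l, forall x, x < nl t -> bit x F = bit x (nF t),
              exists2 x, nl t <= x < l & bit x F
            & forall x, nl t <= x < l -> bit x F -> A x /\ V x]
        & forall B s x y b, cone F l (fun x => A x && V x) B ->
            Phi (nlev t) B s x y -> f x = Some b -> y = b]
  end.

(** If [A] and [V] share an element a beyond [nl t], add it first; then either no oracle of the new
    cone contradicts [f], or a finite part of one that does gives a conflict. *)
Lemma exists_status (A : nat -> bool) f t (V : nat -> bool) :
  exists st, status_spec A f t V st.
Proof.
case: (pselect (exists x, [/\ nl t <= x, A x & V x])); last first.
  by move=> H; exists (Dead (nl t)) => x lx Ax Vx; apply: H; exists x.
move=> [a [la Aa Va]].
pose F := tab a.+1 (fun x => if x < nl t then bit x (nF t) else x == a).
have bF x : bit x F = if x < nl t then bit x (nF t) else x == a.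
  rewrite bit_tab; case: (ltnP x (nl t)) => [lt|_].
    by rewrite ltnS (leq_trans (ltnW lt) la).
  by case: eqP => [->|]; rewrite ?ltnSn ?andbF.
have S1 : nl t < a.+1 by rewrite ltnS.
have S2 x : x < nl t -> bit x F = bit x (nF t) by move=> lt; rewrite bF lt.
have S3 : exists2 x, nl t <= x < a.+1 & bit x F.
  by exists a; rewrite ?la ?ltnSn// bF ltnNge la eqxx.
have S4 x : nl t <= x < a.+1 -> bit x F -> A x /\ V x.
  by move=> /andP[lx _]; rewrite bF ltnNge lx /= => /eqP ->.
case: (pselect (forall B s x y b, cone F a.+1 (fun x => A x && V x) B ->
  Phi (nlev t) B s x y -> f x = Some b -> y = b)).
  by move=> H; exists (Stuck F a.+1).
move=> /existsNP[B /existsNP[s /existsNP[x /existsNP[y /existsNP[b]]]]].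
move=> /not_implyP[BF /not_implyP[HB /not_implyP[fx yb]]].
(* The contradicting oracle is cut at a length that covers both a and the use s. *)
pose l' := maxn a.+1 s; pose F' := tab l' B.
have bF' i : i < l' -> bit i F' = B i by move=> lt; rewrite bit_tab lt.
have l'a : a < l' by rewrite leq_max ltnSn.
have Bt : cone (nF t) (nl t) (fun x => A x && V x) B.
  apply: cone_trans BF => //; first exact: ltnW.
  by move=> z lz /S4[]// -> ->.
exists (Conflict (F', l', ncs t, (nlev t).+1) l'); split.
  split=> //=.
  - exact: leq_trans l'a.
  - move=> z lz; rewrite bF'; first by have [->] := Bt.
    exact: leq_trans lz (leq_trans la (ltnW l'a)).
  - exists a; rewrite ?la ?l'a//= bF'//.
    by have [-> //] := BF; rewrite bF ltnNge la eqxx.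
  - move=> z /andP[lz zl'] /=; rewrite bF'// => Bz.
    by have [_ /(_ z lz Bz)/andP[]] := Bt.
  - split=> //; left; split=> //; exists x, y, b; split=> //.
    apply: Phi_mono (leq_maxr a.+1 s) _.
    rewrite (@Phi_use _ _ B)// => i lt; apply: bF'.
    by rewrite leq_max lt orbT.
move=> V' VV' okV' B' HB'; apply: okV'; apply: cone_trans HB' => //=.
- exact: leq_trans la (ltnW l'a).
- move=> z lz; rewrite bF'; first by have [->] := Bt.
  exact: leq_trans lz (leq_trans la (ltnW l'a)).
- move=> z /andP[lz zl']; rewrite bF'// => Bz.
  by rewrite -VV'//; have [_ /(_ z lz Bz)/andP[]] := Bt.
Qed.

(** A configuration is a single set: column 0 plays the role of [A], and column j + 1 is the j-th
    piece. *)
Definition sec (Z : nat -> bool) j x := Z (cpair j x).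

(** [u] codes a pair (c, p), where p is a valuation of the inputs (c, i), i < N. A stuck piece is
    violated when its program halts on one of them with a value other than digit i of p. *)
Definition status_viol (N e j : nat) st (Z : nat -> bool) (u : nat) : Prop :=
  match st with
  | Dead k => exists x, [&& k <= x, sec Z 0 x & sec Z j x]
  | Conflict _ _ => False
  | Stuck F l => exists B s x y,
      [/\ cone F l (fun x => sec Z 0 x && sec Z j x) B, Phi e B s x y
        & has (fun i => (x == cpair (cfst u) i) && (y != bit i (csnd u)))
            (iota 0 N)]
  end.

Lemma computable_sec j a : computable a ->
  computable (fun Z x => sec Z j (a Z x)).
Proof.
move=> Ha; apply: (computable_oracle (a := fun Z x => cpair j (a Z x))).
by prove_computable.
Qed.

Lemma semidecidable_status N e j st : semidecidable (status_viol N e j st).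
Proof.
case: st => [k|t' M|F l] /=.
- apply: (@semidecidable_exists (fun Z x => [&& k <= x, sec Z 0 x & sec Z j x])).
  by prove_computable; apply: computable_sec; exact: computable_id.
- exact: semidecidable_False.
- apply: (@semidecidable_cone F l e (fun Z x => sec Z 0 x && sec Z j x)
    (fun u x y => has (fun i => (x == cpair (cfst u) i) &&
       (y != bit i (csnd u) :> nat)) (iota 0 N))).
    by prove_computable; apply: computable_sec; exact: computable_id.
  by prove_computable.
Qed.

Lemma semidecidable_not_ok t j :
  semidecidable (fun Z _ => ~ ok t (sec Z j)).
Proof.
have H : semidecidable (fun Z (_ : nat) => exists2 en, en \in ncs t &
    exists B s n y, [/\ cone (nF t) (nl t) (sec Z j) B, Phi en.1 B s n y
      & n == en.2]).
  apply: semidecidable_exists_in => en _.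
  apply: (@semidecidable_cone _ _ _ (fun Z => sec Z j)
    (fun _ n _ => n == en.2)).
    by apply: computable_sec; exact: computable_id.
  by prove_computable.
apply: semidecidable_ext H => Z x; split.
  move=> [[e n'] en [B [s [n [y [HB HP /eqP /= nE]]]]]] H; subst n'.
  by move/negP: (H B HB e n s y en).
move=> /existsNP[B /not_implyP[HB]].
move=> /existsNP[e /existsNP[n /existsNP[s /existsNP[y]]]].
move=> /not_implyP[en /negP]; rewrite negbK => HP.
by exists (e, n) => //; exists B, s, n, y.
Qed.

Lemma bit_inj N p q : p < 2 ^ N -> q < 2 ^ N -> p != q ->
  exists2 i, i < N & bit i p != bit i q.
Proof.
move=> pN qN pq; apply: contrapT => H; move/eqP: pq; apply.
rewrite -(tab_bit pN) -(tab_bit qN); apply: eq_tab => i iN.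
by apply/eqP; apply: contrapT => /negP Hi; apply: H; exists i.
Qed.

(* The sets [sec (Zp p) 0] play the role of [A] for valuations [p] of [N] inputs
   of [f]. Where two of them meet, the program of the piece would have to agree
   with both valuations, so it diverges. *)
Lemma splitting A f (ts : seq node) (R : (nat -> bool) -> nat -> bool) Z0 k0 N :
  diagonalizes f -> computable R -> (forall n, k0 <= n -> R Z0 n) ->
  (forall x, sec Z0 0 x = A x) ->
  (forall j, j < size ts -> ok (nth root_node ts j) (sec Z0 j.+1)) ->
  exists (Zp : nat -> nat -> bool) (W : nat -> seq (node * (nat -> bool))) k1,
  [/\ forall p n, p < 2 ^ N -> k0 <= n -> R (Zp p) n,
      forall p j, p < 2 ^ N -> j < size ts ->
        ok (nth root_node ts j) (sec (Zp p) j.+1),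
      forall j w, j < size ts -> w \in W j ->
        child A f (nth root_node ts j) w.1 /\ ok w.1 w.2
    & forall j x p q, j < size ts -> k1 <= x -> p < 2 ^ N -> q < 2 ^ N ->
        p != q -> sec (Zp p) 0 x -> sec (Zp p) j.+1 x ->
        sec (Zp q) 0 x -> sec (Zp q) j.+1 x -> has (fun w => w.2 x) (W j)].
Proof.
move=> Hf HR RZ0 Z0A okZ0; set m := size ts.
have /choice[st Hst] j : exists st,
    status_spec A f (nth root_node ts j) (sec Z0 j.+1) st.
  exact: exists_status.
pose bnd j := match st j with Conflict _ M => M | Stuck _ l => l | Dead k => k end.
pose k1 := \max_(j < m) bnd j.
(* Agreement of configurations below [M] forces their columns j + 1 to agree below [bnd j]. *)
pose M := \max_(j < m) \max_(x < bnd j) (cpair j.+1 x).+1.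
have ltM j x : j < m -> x < bnd j -> cpair j.+1 x < M.
  move=> jm xj; have jM := leq_bigmax (F := fun j : 'I_m =>
    \max_(x < bnd j) (cpair j.+1 x).+1) (Ordinal jm).
  apply: leq_trans jM.
  exact: (leq_bigmax (F := fun x : 'I_(bnd j) => (cpair j.+1 x).+1) (Ordinal xj)).
have lek1 j : j < m -> bnd j <= k1.
  by move=> jm; exact: (leq_bigmax (F := fun j : 'I_m => bnd j) (Ordinal jm)).
(* The ways in which a configuration can fail: a piece is no longer [ok], the window condition
   fails, it departs from [Z0] below [M], or a status is violated for the valuation in [u]. *)
pose O (Z : nat -> bool) u :=
  (exists2 j, j \in iota 0 m & ~ ok (nth root_node ts j) (sec Z j.+1)) \/
  ((exists n, (k0 <= n) && ~~ R Z n) \/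
  ((exists x, (x < M) && (Z x != bit x (tab M Z0) :> nat)) \/
  (exists2 j, j \in iota 0 m &
     status_viol N (nlev (nth root_node ts j)) j.+1 (st j) Z u))).
have [h Hh HO] : semidecidable O.
  apply: semidecidable_or.
    by apply: semidecidable_exists_in => j _; exact: semidecidable_not_ok.
  apply: semidecidable_or.
    apply: (@semidecidable_exists (fun Z n => (k0 <= n) && ~~ R Z n)).
    by prove_computable.
  apply: semidecidable_or.
    apply: (@semidecidable_exists (fun Z x =>
      (x < M) && (Z x != bit x (tab M Z0) :> nat))).
    by prove_computable.
  by apply: semidecidable_exists_in => j _; exact: semidecidable_status.
(* Diagonalize against the [u] for which every configuration fails. Were p the valuation given by
   [f], then [Z0] would fail, although its stuck programs never contradict [f]. Hence every p has a
   configuration that does not fail. *)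
have [c [[p Pp fp]|Hc]] := Hf _ (ce_forall_oracle Hh).
  exfalso; have /HO : exists w, h Z0 (cpair (cpair c p) w) by exact: Pp.
  case=> [[j]|[[n]|[[x]|[j]]]].
  - by rewrite mem_iota => jm; apply; exact: okZ0.
  - by move=> /andP[/RZ0 ->].
  - by move=> /andP[xM]; rewrite bit_tab xM eqxx.
  - rewrite mem_iota => jm; move: (Hst j).
    case: (st j) => [k|//|F l] /=.
      move=> H [x /and3P[kx Ax Vx]]; apply: (H x) => //; by rewrite -Z0A.
    move=> [_ H] [B [s [x [y [HB HP /hasP[i _ /andP[/eqP xE yn]]]]]]].
    subst x; rewrite csnd_cpair cfst_cpair in HP yn.
    move: yn; rewrite (H B s _ y _ _ HP (fp i)) ?eqxx//.
    by apply: coneS HB => x; rewrite Z0A.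
have /choice[Zp HZp] p : exists Z, ~ O Z (cpair c p).
  have /existsNP[Z HZ] := Hc p; exists Z => /HO; exact: HZ.
have okZ p j : j < m -> ok (nth root_node ts j) (sec (Zp p) j.+1).
  move=> jm; apply: contrapT => H; apply: (HZp p); left.
  by exists j => //; rewrite mem_iota.
have agZ p j x : j < m -> x < bnd j -> sec (Zp p) j.+1 x = sec Z0 j.+1 x.
  move=> jm /(ltM _ _ jm) xM; apply/eqP; apply: contrapT => H; apply: (HZp p).
  right; right; left; exists (cpair j.+1 x); rewrite xM bit_tab xM /=.
  move: H; rewrite /sec; by case: (Zp _ _) (Z0 _) => -[] //; case.
have stZ p j : j < m ->
    ~ status_viol N (nlev (nth root_node ts j)) j.+1 (st j) (Zp p) (cpair c p).
  by move=> jm H; apply: (HZp p); do 3 right; exists j => //; rewrite mem_iota.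
pose ix p q := find (fun i => bit i p != bit i q) (iota 0 N).
have ixP p q : p < 2 ^ N -> q < 2 ^ N -> p != q ->
    ix p q < N /\ bit (ix p q) p != bit (ix p q) q.
  move=> pN qN pq; have [i iN Hi] := bit_inj pN qN pq.
  have H : has (fun i => bit i p != bit i q) (iota 0 N).
    by apply/hasP; exists i => //; rewrite mem_iota.
  have lt : ix p q < N by move: H; rewrite has_find size_iota.
  by split=> //; have := nth_find 0 H; rewrite nth_iota.
pose S j pq x := [&& sec (Zp pq.1) 0 x, sec (Zp pq.1) j.+1 x,
  sec (Zp pq.2) 0 x & sec (Zp pq.2) j.+1 x].
pose pairs := [seq pq <- [seq (p, q) | p <- iota 0 (2 ^ N), q <- iota 0 (2 ^ N)]
  | pq.1 != pq.2].
have pairsP p q : ((p, q) \in pairs) = [&& p != q, p < 2 ^ N & q < 2 ^ N].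
  rewrite mem_filter /=; congr (_ && _); apply/allpairsP/andP.
    by move=> [[p' q'] [/= + + [-> ->]]]; rewrite !mem_iota.
  by move=> [pN qN]; exists (p, q); rewrite !mem_iota.
(* A conflict is carried over to the piece of each configuration. In the stuck case the intersection
   for p and q gets a node recording divergence at the input that separates them. In the dead case
   no points beyond [k1] remain to be covered. *)
pose W j : seq (node * (nat -> bool)) := let t := nth root_node ts j in
  match st j with
  | Dead _ => [::]
  | Conflict t' _ => [seq (t', sec (Zp p) j.+1) | p <- iota 0 (2 ^ N)]
  | Stuck F l => [seq ((F, l, (nlev t, cpair c (ix pq.1 pq.2)) :: ncs t,
      (nlev t).+1) : node, S j pq) | pq <- pairs]
  end.
exists Zp, W, k1; split.
- move=> p n _ k0n; apply: contrapT => /negP H; apply: (HZp p).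
  by right; left; exists n; rewrite k0n.
- by move=> p j _; exact: okZ.
- move=> j w jm; rewrite /W; move: (Hst j) (fun p x => agZ p j x jm) (fun p => stZ p j jm).
  rewrite /bnd; case: (st j) => [//|t' M'|F l] /=.
    move=> [cht' okt'] ag _ /mapP[p pN ->] /=; split=> //.
    by apply: okt'; [move=> x xM; rewrite ag|exact: okZ].
  move=> [[S1 S2 S3 S4] _] ag nv /mapP[[p q]].
  rewrite pairsP => /and3P[pq pN qN] -> /=; split.
    split=> //=; first by move=> x lx Fx; have [] := S4 x lx Fx.
    by split=> //; right; exists (cpair c (ix p q)).
  have [ixN ixb] := ixP p q pN qN pq.
  have ixy r B s y : cone F l (fun x => sec (Zp r) 0 x && sec (Zp r) j.+1 x) B ->
      Phi (nlev (nth root_node ts j)) B s (cpair c (ix p q)) y ->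
      y = bit (ix p q) r.
    move=> HB HP; apply/eqP; apply: contrapT => /negP yr; apply: (nv r).
    exists B, s, (cpair c (ix p q)), y; split=> //.
    by apply/hasP; exists (ix p q); rewrite ?mem_iota// !cpairE eqxx.
  move=> B HB e n s y; rewrite inE => /predU1P[[-> ->]|en].
    (* The oracle lies in the cones of both configurations, so a halting computation would return
       two distinct digits. *)
    apply/negP => HP; move: ixb.
    have HBp : cone F l (fun x => sec (Zp p) 0 x && sec (Zp p) j.+1 x) B.
      by apply: coneS HB => x /and4P[-> ->].
    have HBq : cone F l (fun x => sec (Zp q) 0 x && sec (Zp q) j.+1 x) B.
      by apply: coneS HB => x /and4P[_ _ -> ->].
    have := ixy _ _ _ _ HBp HP; rewrite (ixy _ _ _ _ HBq HP).
    by case: (bit _ q) (bit _ p) => -[].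
  (* The new elements of [F] come from the piece of [Z0], with which that of [Zp p] agrees below
     l. *)
  apply: (okZ p j jm B) en; apply: cone_trans HB => //=; first exact: ltnW.
    by move=> x lx Fx; rewrite ag; [have [] := S4 x lx Fx|case/andP: lx].
  by move=> x /and4P[].
- move=> j x p q jm k1x pN qN pq Xp Vp Xq Vq; rewrite /W.
  move: (stZ p j jm) (lek1 j jm); rewrite /bnd; case: (st j) => [k|t' M'|F l] /=.
  + by move=> H lek; case: H; exists x; rewrite (leq_trans lek)// Xp.
  + move=> _ _; rewrite has_map; apply/hasP; exists p; rewrite ?mem_iota//.
  + move=> _ _; rewrite has_map; apply/hasP; exists (p, q) => /=.
      by rewrite pairsP pq pN.
    by rewrite /S /= Xp Vp Xq.
Qed.

(** * Densities in the windows [n, C n) *)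

Definition cnt C (P : nat -> bool) n := \sum_(0 <= x < C * n) ((n <= x) && P x).

Lemma cnt_le C P n : cnt C P n <= C * n.
Proof.
rewrite -[X in _ <= X]muln1 -[X in _ <= X * _]subn0 -sum_nat_const_nat.
by apply: leq_sum => x _; case: (_ && _).
Qed.

Lemma cnt_sub C (P Q : nat -> bool) n :
  (forall x, n <= x -> P x -> Q x) -> cnt C P n <= cnt C Q n.
Proof.
move=> PQ; apply: leq_sum => x _.
by case nx: (n <= x) => //=; case Px: (P x) => //; rewrite (PQ x nx Px).
Qed.

Lemma cntU C (P Q : nat -> bool) n :
  cnt C (fun x => P x || Q x) n <= cnt C P n + cnt C Q n.
Proof.
rewrite /cnt -big_split /=; apply: leq_sum => x _.
by case: (n <= x) (P x) (Q x) => -[] [].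
Qed.

Lemma cnt_split C (P Q : nat -> bool) n : (forall x, P x -> Q x) ->
  cnt C Q n = cnt C P n + cnt C (fun x => Q x && ~~ P x) n.
Proof.
move=> PQ; rewrite /cnt -big_split /=; apply: eq_bigr => x _.
by case Px: (P x); rewrite ?(PQ x Px); case: (n <= x) (Q x) => -[].
Qed.

(** Each piece is attached to the node that it continues; a node may carry several pieces. *)
Definition system := seq (node * (nat -> bool)).

Definition sound (S : system) := forall w, w \in S -> ok w.1 w.2.

Definition covered (L : seq node) (S : system) x :=
  has (fun w => (w.1 \in L) && w.2 x) S.

Definition childb A f (L : seq node) (t' : node) :=
  `[< exists2 t, t \in L & child A f t t' >].

Definition childcover A f (L : seq node) (S : system) x :=
  has (fun w => childb A f L w.1 && w.2 x) S.

Definition top (D : seq (seq node * nat)) :=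
  if D is (L, _) :: _ then L else [:: root_node].

(* [D] lists, from the last level down to the first, the nodes [L] of the level
   and the density [s] reached by their pieces, in units of [n / 2 ^ level].
   Lexicographically, a system either attains these densities in a window
   ([holds]) or exceeds them at some level ([escapes]); an excess may be due to
   pieces of new nodes, as long as their parents are in the lower level. *)
Fixpoint holds C (D : seq (seq node * nat)) S n :=
  if D is (L, s) :: D' then
    holds C D' S n && (s * n <= 2 ^ (size D').+1 * cnt C (covered L S) n)
  else true.

Fixpoint escapes C A f (D : seq (seq node * nat)) S n :=
  if D is (_, s) :: D' then
    escapes C A f D' S n || (holds C D' S n &&
      (s.+1 * n <= 2 ^ (size D').+1 * cnt C (childcover A f (top D') S) n))
  else false.

(** With the empty piece, [ok] says that the finite set of the node alone starts no forbidden
    computation; this is what the final union uses. *)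
Fixpoint wf A f (D : seq (seq node * nat)) := if D is (L, _) :: D' then
  (forall t, t \in L -> childb A f (top D') t /\ ok t (fun=> false)) /\ wf A f D'
  else True.

Lemma sub_has (S S' : system) (P : pred (node * (nat -> bool))) :
  {subset S <= S'} -> has P S -> has P S'.
Proof. by move=> SS' /hasP[w /SS' wS Pw]; apply/hasP; exists w. Qed.

Lemma holds_mono C D S S' n : {subset S <= S'} -> holds C D S n -> holds C D S' n.
Proof.
move=> SS'; elim: D => //= -[L s] D IH /andP[/IH -> /=] /leq_trans; apply.
by rewrite leq_mul2l; apply/orP; right; apply: cnt_sub => x _; exact: sub_has.
Qed.

Lemma escapes_mono C A f D S S' n : {subset S <= S'} ->
  escapes C A f D S n -> escapes C A f D S' n.
Proof.
move=> SS'; elim: D => //= -[L s] D IH /orP[/IH -> //|].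
move=> /andP[/(holds_mono SS') -> /= H]; apply/orP; right.
apply: leq_trans H _; rewrite leq_mul2l; apply/orP; right.
by apply: cnt_sub => x _; exact: sub_has.
Qed.

(** * Counting in one window *)

Section Gain.
Variables (C : nat) (A : nat -> bool) (f : nat -> option bool) (n : nat).
Implicit Types (X : nat -> bool) (S : system) (D : seq (seq node * nat)).

Definition bad X S S' L :=
  cnt C (fun x => [&& X x, covered L S x & ~~ childcover A f L S' x]) n.

Fixpoint badsum X S S' D :=
  if D is _ :: D' then bad X S S' (top D') + badsum X S S' D' else 0.

(** By induction on the levels. A point of [X] missed at the new level was missed one level below,
    or is bad, or lies in a child piece of [S'] outside [covered L S]. Without an escape the last
    kind makes up less than n / 2^(k+1) points at level k + 1, and these bounds add up to (1 - 2^-k)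
    n at level k. *)
Lemma uncovered X S (S' : system) D : wf A f D -> {subset S <= S'} ->
  (forall x, n <= x -> x < C * n -> covered [:: root_node] S x) -> holds C D S n ->
  escapes C A f D S' n \/
  2 ^ size D * cnt C (fun x => X x && ~~ covered (top D) S x) n <=
    (2 ^ size D - 1) * n + 2 ^ size D * badsum X S S' D.
Proof.
move=> wfD SS' rootS; elim: D wfD => [_ _|[L s] D IH [LD wfD]].
  right; rewrite /= /cnt big_nat big1 ?muln0// => x /andP[_ xC].
  by case nx: (n <= x) => //=; rewrite rootS ?andbF.
move=> /= /andP[HD sL]; have [-> |{}IH] := IH wfD HD; first by left.
rewrite (holds_mono SS' HD) /=.
case: leqP => [_|esc]; first by rewrite orbT; left.
right; move: esc; set Ch := childcover A f (top D) S'; set U := covered L S.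
have UCh x : U x -> Ch x.
  move=> /hasP[w wS /andP[wL wx]]; apply/hasP; exists w; first exact: SS'.
  by have [-> _] := LD _ wL.
rewrite (cnt_split _ _ UCh) => esc.
have le : cnt C (fun x => X x && ~~ U x) n <=
    cnt C (fun x => X x && ~~ covered (top D) S x) n + bad X S S' (top D) +
    cnt C (fun x => Ch x && ~~ U x) n.
  apply: leq_trans (leq_add (cntU _ _ _ _) (leqnn _)).
  apply: leq_trans (cntU _ _ _ _).
  apply: cnt_sub => x _ /andP[-> ->] /=; rewrite -/Ch.
  by case: (covered _ _ x) (Ch x) => -[].
rewrite expnS in sL esc *; have := expn_gt0 2 (size D).
move: (2 ^ size D) sL esc le IH => q; rewrite -/U.
move: (cnt C _ n) (cnt C _ n) (cnt C _ n) (cnt C _ n) (bad _ _ _ _) (badsum _ _ _ _).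
move=> a b c d e g; nia.
Qed.

(** At least n / 2^k points of [X] minus [badsum] are covered at the top level k. The bad points
    take away at most half of n / 2^k in all, and the rest lie in child pieces. *)
Lemma gain X S (S' : system) D : wf A f D -> {subset S <= S'} ->
  (forall x, n <= x -> x < C * n -> covered [:: root_node] S x) -> holds C D S n ->
  n <= cnt C X n ->
  2 ^ (size D).+1 * (bad X S S' (top D) + badsum X S S' D) <= n ->
  escapes C A f D S' n \/
  n <= 2 ^ (size D).+1 * cnt C (childcover A f (top D) S') n.
Proof.
move=> wfD SS' rootS HD nX small.
have [esc|un] := @uncovered X S S' D wfD SS' rootS HD; [by left|right].
have le : cnt C X n <= cnt C (fun x => X x && ~~ covered (top D) S x) n +
    bad X S S' (top D) + cnt C (childcover A f (top D) S') n.
  apply: leq_trans (leq_add (cntU _ _ _ _) (leqnn _)).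
  apply: leq_trans (cntU _ _ _ _).
  apply: cnt_sub => x _ -> /=.
  by case: (covered _ _ x) (childcover _ _ _ _ x) => -[].
rewrite expnS in small *; have := expn_gt0 2 (size D).
move: (2 ^ size D) small un (leq_trans nX le) => q.
move: (cnt C _ n) (cnt C _ n) (bad _ _ _ _) (badsum _ _ _ _).
move=> a b c d; nia.
Qed.

(** Double counting: at each of the [(size D).+1] levels, root level included, a point of the window
    is bad for at most [m] of the indices p. *)
Lemma badsum_total (P m : nat) (Xp : nat -> nat -> bool) (Sp : nat -> system) S' D :
  (forall L x, n <= x ->
    \sum_(p < P) [&& Xp p x, covered L (Sp p) x & ~~ childcover A f L S' x] <= m) ->
  \sum_(p < P) (bad (Xp p) (Sp p) S' (top D) + badsum (Xp p) (Sp p) S' D) <=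
  (size D).+1 * (m * (C * n)).
Proof.
move=> Hm.
have one L : \sum_(p < P) bad (Xp p) (Sp p) S' L <= m * (C * n).
  have -> : m * (C * n) = \sum_(0 <= x < C * n) m.
    by rewrite sum_nat_const_nat subn0 mulnC.
  rewrite /bad /cnt exchange_big /=; apply: leq_sum => x _.
  case nx: (n <= x) => /=; first exact: Hm.
  by rewrite big1.
rewrite big_split /= mulSn leq_add//.
elim: D => [|[L s] D IH] /=; first by rewrite big1.
by rewrite big_split /= mulSn leq_add.
Qed.

End Gain.

Lemma computable_has_seq (T : Type) (s : seq T)
    (P : T -> (nat -> bool) -> nat -> bool) : (forall t, computable (P t)) ->
  computable (fun Z x => has (fun t => P t Z x) s).
Proof.
move=> HP; elim: s => [|t s IH]; first exact: (computable_const 0).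
exact: computable_or.
Qed.

Lemma computable_cnt C (P : (nat -> bool) -> nat -> bool) : computable P ->
  computable (fun Z n => cnt C (P Z) n).
Proof.
move=> HP; rewrite /cnt.
apply: (@computable_sum (fun Z n x => (n <= x) && P Z x)).
  by prove_computable.
prove_computable; apply: (computable_comp HP); by prove_computable.
Qed.

(** * Systems read off from configurations *)

Definition pieces (ts : seq node) (Z : nat -> bool) : system :=
  [seq (nth root_node ts j, sec Z j.+1) | j <- iota 0 (size ts)].

(** [Q] is evaluated only at the finitely many fixed nodes [ts], so its values are constants of the
    program. This is how [childb], and with it [A] and [f], enters computable conditions. *)
Lemma computable_cover_pieces (Q : pred node) ts :
  computable (fun Z x => has (fun w => Q w.1 && w.2 x) (pieces ts Z)).
Proof.
have H : computable (fun Z x =>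
    has (fun j => Q (nth root_node ts j) && sec Z j.+1 x) (iota 0 (size ts))).
  apply: computable_has_seq => j; apply: computable_and.
    exact: computable_const.
  by apply: computable_sec; exact: computable_id.
by apply: computable_ext H => Z x; rewrite has_map.
Qed.

Lemma computable_holds C D ts : computable (fun Z n => holds C D (pieces ts Z) n).
Proof.
elim: D => [|[L s] D IH] /=; first exact: (computable_const 1).
have H := computable_cnt C (computable_cover_pieces (fun t => t \in L) ts).
by prove_computable.
Qed.

Lemma computable_escapes C A f D ts :
  computable (fun Z n => escapes C A f D (pieces ts Z) n).
Proof.
elim: D => [|[L s] D IH] /=; first exact: (computable_const 0).
have H := computable_cnt C (computable_cover_pieces (childb A f (top D)) ts).
have H' := computable_holds C D ts.
by prove_computable.
Qed.

Lemma sum_at_most_one P (b : nat -> bool) :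
  (forall p q, p < P -> q < P -> b p -> b q -> p = q) -> \sum_(p < P) b p <= 1.
Proof.
move=> Hb; case: (pselect (exists2 p, p < P & b p)); last first.
  move=> H; rewrite big1// => p _; case bp: (b p) => //.
  by case: H; exists p.
move=> [p pP bp]; rewrite (bigD1 (Ordinal pP)) //= bp big1// => q qp.
case bq: (b q) => //; case/eqP: qp; apply: val_inj => /=.
exact: Hb.
Qed.

Definition almost_all (Q : nat -> bool) := exists k, forall n, k <= n -> Q n.

(* If a window escapes for one of the [2 ^ N] systems, it does for their union.
   Otherwise the points covered twice add to some level by [gain]. *)
Lemma improve C A f D S : diagonalizes f -> almost_all (fun n => n <= cnt C A n) ->
  wf A f D -> sound S ->
  almost_all (fun n => escapes C A f D S n || holds C D S n) ->
  exists2 S', sound S' & almost_all (fun n => escapes C A f D S' n ||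
    (holds C D S' n && (n <= 2 ^ (size D).+1 * cnt C (childcover A f (top D) S') n))).
Proof.
move=> Hf [kA HA] wfD sS [kS HS].
(* The root with the full piece makes level 0 cover every point, the base case of the count. *)
pose S0 : system := (root_node, fun=> true) :: S.
pose ts := [seq w.1 | w <- S0]; set m := size ts.
have mE : m = size S0 by rewrite /m size_map.
pose Z0 u := if cfst u is j.+1 then (nth (root_node, fun=> true) S0 j).2 (csnd u)
  else A (csnd u).
have Z0A x : sec Z0 0 x = A x by rewrite /sec /Z0 !cpairE.
have Z0S j : sec Z0 j.+1 = (nth (root_node, fun=> true) S0 j).2.
  by apply/funext => x; rewrite /sec /Z0 !cpairE.
have tsE j : nth root_node ts j = (nth (root_node, fun=> true) S0 j).1.
  have [jm|mj] := ltnP j m; first by rewrite (nth_map (root_node, fun=> true)) -?mE.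
  by rewrite !nth_default// -mE.
have piecesZ0 : pieces ts Z0 = S0.
  rewrite /pieces -/m mE -[RHS](mkseq_nth (root_node, fun=> true)) /mkseq.
  by apply: eq_map => j; rewrite Z0S tsE; case: nth.
(* The last test keeps the root piece, column 1, full on the window in every configuration. *)
pose R Z n := [&& escapes C A f D (pieces ts Z) n || holds C D (pieces ts Z) n,
  n <= cnt C (sec Z 0) n & cnt C (fun x => ~~ sec Z 1 x) n == 0].
have HR : computable R.
  have H1 := computable_holds C D ts; have H2 := computable_escapes C A f D ts.
  have H3 : computable (fun Z n => cnt C (sec Z 0) n).
    by apply: computable_cnt; apply: computable_sec; exact: computable_id.
  have H4 : computable (fun Z n => cnt C (fun x => ~~ sec Z 1 x) n).
    apply: (computable_cnt C (P := fun Z x => ~~ sec Z 1 x)).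
    by apply: computable_neg; apply: computable_sec; exact: computable_id.
  by rewrite /R; prove_computable.
have SS0 : {subset S <= S0} by move=> w; rewrite inE => ->; rewrite orbT.
have RZ0 n : maxn kA kS <= n -> R Z0 n.
  rewrite geq_max => /andP[kAn kSn]; rewrite /R piecesZ0; apply/and3P; split.
  - by case/orP: (HS n kSn) => [/(escapes_mono SS0) ->|/(holds_mono SS0) ->];
      rewrite ?orbT.
  - by apply: leq_trans (HA n kAn) _; apply: cnt_sub => x _; rewrite Z0A.
  - by rewrite Z0S /= /cnt big1// => x _; rewrite andbF.
have okZ0 j : j < m -> ok (nth root_node ts j) (sec Z0 j.+1).
  rewrite mE tsE Z0S; case: j => [_|j jm].
    by move=> B _ e k s y; rewrite in_nil.
  by apply: sS; exact: mem_nth.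
(* The bad counts of all 2^N configurations, scaled by [2 ^ (size D).+1], sum to at most N n. As N <
   2^N, one configuration has a share of at most n. *)
pose N := (size D).+1 * (m * C) * 2 ^ (size D).+1.
have [Zp [W [k1 [RZp okZp HW cross]]]] := splitting N Hf HR RZ0 Z0A okZ0.
pose S' : system := flatten [seq pieces ts (Zp p) | p <- iota 0 (2 ^ N)] ++
  flatten [seq W j | j <- iota 0 m].
have sub p : p < 2 ^ N -> {subset pieces ts (Zp p) <= S'}.
  move=> pN w wp; rewrite mem_cat; apply/orP; left; apply/flattenP.
  by exists (pieces ts (Zp p)) => //; apply/mapP; exists p => //; rewrite mem_iota.
exists S'.
  move=> w; rewrite mem_cat => /orP[] /flattenP[s /mapP[p]]; rewrite mem_iota => lt -> .
    move=> /mapP[j]; rewrite mem_iota => jm -> /=; exact: okZp.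
  by move=> /(HW p _ lt)[].
exists (maxn k1 (maxn kA kS)) => n; rewrite geq_max => /andP[k1n kn].
case: (pselect (exists2 p, p < 2 ^ N & escapes C A f D (pieces ts (Zp p)) n)).
  by move=> [p pN /(escapes_mono (sub p pN)) ->].
move=> Nesc.
have Hp p : p < 2 ^ N -> [/\ holds C D (pieces ts (Zp p)) n, n <= cnt C (sec (Zp p) 0) n
    & forall x, n <= x -> x < C * n -> covered [:: root_node] (pieces ts (Zp p)) x].
  move=> pN; have /and3P[/orP[esc|-> ] -> /eqP H0] := RZp p n pN kn.
    by case: Nesc; exists p.
  split=> // x nx xC; apply/hasP; exists (root_node, sec (Zp p) 1).
    by apply/mapP; exists 0; rewrite ?mem_iota.
  rewrite mem_seq1 eqxx /=; move/eqP: H0; rewrite /cnt sum_nat_seq_eq0.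
  by move=> /allP/(_ x); rewrite mem_index_iota xC nx /= => /(_ isT); case: sec.
have one L x : n <= x -> \sum_(p < 2 ^ N) [&& sec (Zp p) 0 x,
    covered L (pieces ts (Zp p)) x & ~~ childcover A f L S' x] <= m.
  move=> nx; pose b j p := [&& sec (Zp p) 0 x, nth root_node ts j \in L,
    sec (Zp p) j.+1 x & ~~ childcover A f L S' x].
  apply: (@leq_trans (\sum_(p < 2 ^ N) \sum_(j < m) b j p)).
    apply: leq_sum => p _; case E: [&& _, _ & _] => //.
    move/and3P: E => [Xp /hasP[w /mapP[j]]].
    rewrite mem_iota => jm -> /andP[/= tL Vx] nc.
    by rewrite (bigD1 (Ordinal jm)) //= /b Xp tL Vx nc.
  (* For each piece j a point is bad for at most one p: were it bad for p and q, it would lie in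
     both pieces and hence in a child piece from [W j]. *)
  rewrite exchange_big /= -[X in _ <= X]card_ord -sum1_card; apply: leq_sum => j _.
  apply: sum_at_most_one => p q pN qN /and4P[Xp tL Vp nc] /and4P[Xq _ Vq _].
  apply/eqP; apply: contraNT nc => pq.
  have /hasP[w wW wx] := cross j x p q (ltn_ord j) (leq_trans k1n nx) pN qN pq Xp Vp Xq Vq.
  have [chw _] := HW j w (ltn_ord j) wW.
  apply/hasP; exists w.
    rewrite mem_cat; apply/orP; right; apply/flattenP; exists (W j) => //.
    by apply/mapP; exists (val j) => //; rewrite mem_iota /=.
  by rewrite wx andbT; apply/asboolP; exists (nth root_node ts j).
have total := badsum_total (Sp := fun p => pieces ts (Zp p))
  (Xp := fun p => sec (Zp p) 0) C D one.
have [p pN small] : exists2 p, p < 2 ^ N & 2 ^ (size D).+1 *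
    (bad C A f n (sec (Zp p) 0) (pieces ts (Zp p)) S' (top D) +
     badsum C A f n (sec (Zp p) 0) (pieces ts (Zp p)) S' D) <= n.
  apply: contrapT => H.
  have : \sum_(p < 2 ^ N) n.+1 <= \sum_(p < 2 ^ N) 2 ^ (size D).+1 *
     (bad C A f n (sec (Zp p) 0) (pieces ts (Zp p)) S' (top D) +
     badsum C A f n (sec (Zp p) 0) (pieces ts (Zp p)) S' D).
    apply: leq_sum => p _; rewrite ltnNge; apply/negP => le.
    by apply: H; exists p.
  rewrite -big_distrr /= sum_nat_const card_ord => le1.
  have := leq_trans le1 (leq_mul (leqnn _) total).
  have := ltn_expl N (ltnSn 1).
  rewrite /N; move: (2 ^ (size D).+1) (2 ^ _) => a b; nia.
have [HD nX rootS] := Hp p pN.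
have [-> //|->] := gain wfD (sub p pN) rootS HD nX small.
by rewrite (holds_mono (sub p pN) HD) orbT.
Qed.

(** * The infinite subset *)

(** The third clause is the lexicographic maximality of the densities; the fourth says that they are
    attained in almost all windows that do not escape. *)
Definition inv C A f D := [/\ wf A f D, top D != [::],
  (forall S, sound S -> ~ almost_all (escapes C A f D S)) &
  exists2 S, sound S & almost_all (fun n => escapes C A f D S n || holds C D S n)].

(** The new level takes the largest density [s] attainable: [improve] provides s = 1, and exceeding
    the maximum is exactly an escape at the new level. *)
Lemma extend C A f D : diagonalizes f -> almost_all (fun n => n <= cnt C A n) ->
  inv C A f D -> exists Ls, inv C A f (Ls :: D).
Proof.
move=> Hf HA [wfD topD noesc [S sS HS]].
pose q := 2 ^ (size D).+1.
pose Q s := `[< exists2 S, sound S & almost_all (fun n => escapes C A f D S n ||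
  (holds C D S n && (s * n <= q * cnt C (childcover A f (top D) S) n))) >].
have Q1 : Q 1.
  apply/asboolP; have [S' sS' H] := improve Hf HA wfD sS HS; exists S' => //.
  by have [k Hk] := H; exists k => n /Hk; rewrite mul1n.
(* A window has at most C n points, so a larger s would make all late windows escape; n > 0 is
   ensured by [k.+1]. *)
have Qbound s : Q s -> s <= q * C.
  move=> /asboolP[S' sS' [k Hk]]; rewrite leqNgt; apply/negP => lt.
  apply: (noesc S' sS'); exists k.+1 => n kn.
  have /orP[//|/andP[_ le]] := Hk n (ltnW kn).
  have := leq_trans le (leq_mul (leqnn q) (cnt_le C _ n)).
  by rewrite mulnA leq_mul2r => /orP[]; lia.
have exQ : exists s, Q s by exists 1.
case: (ex_maxnP exQ Qbound) => s /asboolP[S' sS' [k Hk]] smax.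
pose L := [seq w.1 | w <- S' & childb A f (top D) w.1].
have LP t : t \in L -> childb A f (top D) t /\ ok t (fun=> false).
  move=> /mapP[w]; rewrite mem_filter => /andP[cw wS ->]; split=> //.
  by apply: okS (sS' w wS).
have cE n : cnt C (childcover A f (top D) S') n <= cnt C (covered L S') n.
  apply: cnt_sub => x _ /hasP[w wS /andP[cw wx]]; apply/hasP; exists w => //.
  by rewrite wx andbT; apply/mapP; exists w => //; rewrite mem_filter cw.
exists (L, s); split=> //=.
- apply/eqP => L0; apply: (noesc S' sS'); exists k.+1 => n kn.
  have /orP[//|/andP[_ le]] := Hk n (ltnW kn).
  have s0 : 0 < s := smax 1 Q1.
  have := leq_trans le (leq_mul (leqnn q) (cE n)); rewrite L0.
  rewrite /cnt big1 ?muln0; first by rewrite leqn0 muln_eq0; lia.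
  move=> x _; case: (n <= x) => //=; apply/eqP; rewrite eqb0.
  by apply/hasPn => w _; rewrite in_nil.
- move=> S'' sS'' [k' Hk']; have /smax : Q s.+1; last by rewrite ltnn.
  by apply/asboolP; exists S'' => //; exists k'.
- exists S' => //; exists k => n kn; case/orP: (Hk n kn) => [-> //|].
  move=> /andP[-> le] /=; apply/orP; right.
  exact: leq_trans le (leq_mul (leqnn q) (cE n)).
Qed.

(** Adding a level leaves the lower ones unchanged, so the levels form one infinite tree, and
    König's lemma gives a path. *)
Lemma node_chain C A f : diagonalizes f -> almost_all (fun n => n <= cnt C A n) ->
  exists t : nat -> node, [/\ t 0 = root_node, forall n, child A f (t n) (t n.+1)
    & forall n, ok (t n) (fun=> false)].
Proof.
move=> Hf HA.
have /choice[F HF] D : exists Ls, inv C A f D -> inv C A f (Ls :: D).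
  case: (pselect (inv C A f D)) => [/(extend Hf HA)[Ls H]|H].
    by exists Ls.
  by exists ([::], 0) => /H.
pose D n := iter n (fun D => F D :: D) [::].
have invD n : inv C A f (D n).
  elim: n => [|n /HF //]; split=> //=.
    by move=> S _ [k /(_ k (leqnn k))].
  by exists [::] => //; exists 0.
have wfD n t : t \in top (D n.+1) -> childb A f (top (D n)) t /\ ok t (fun=> false).
  by have [/= + _ _ _] := invD n.+1; case: (F _) => L s /= [H _] /H.
have [||t Ht] := @konig node (fun n => top (D n)) (fun _ => child A f).
- by move=> n; have [] := invD n.
- by move=> n t /wfD[/asboolP[t0 t0L ct] _]; exists t0.
exists t; split=> [|n|[|n]].
- by have [+ _] := Ht 0; rewrite mem_seq1 => /eqP.
- by have [] := Ht n.
- have [+ _] := Ht 0; rewrite mem_seq1 => /eqP -> B _ e n s y.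
  by rewrite in_nil.
- by have [/wfD[]] := Ht n.+1.
Qed.

(** Program e is settled at node e + 1. A conflict there contradicts a completion of [f]; a recorded
    divergence contradicts totality, because a halting computation uses only a finite part of the
    union. *)
Lemma chain_union (A : nat -> bool) f (t : nat -> node) : t 0 = root_node ->
  (forall n, child A f (t n) (t n.+1)) -> (forall n, ok (t n) (fun=> false)) ->
  partial_computable f ->
  exists B : set nat, [/\ forall x, B x -> A x, infinite_set B & ~ PA_degree B].
Proof.
move=> t0 ct okt pcf.
have lev n : nlev (t n) = n.
  by elim: n => [|n IH]; [rewrite t0|have [_ _ _ _ [->]] := ct n; rewrite IH].
have nl_ge n : n <= nl (t n).
  by elim: n => // n IH; have [+ _ _ _ _] := ct n; exact: leq_ltn_trans.
have nl_mono n m : n <= m -> nl (t n) <= nl (t m).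
  move=> /subnK <-; elim: (m - n) => // k IH; rewrite addSn.
  by have [/ltnW H _ _ _ _] := ct (k + n); exact: leq_trans IH H.
have coh n m x : n <= m -> x < nl (t n) -> bit x (nF (t m)) = bit x (nF (t n)).
  move=> /subnK <- xn; elim: (m - n) => // k <-; rewrite addSn.
  have [_ H _ _ _] := ct (k + n); apply: H; apply: leq_trans xn _.
  by apply: nl_mono; exact: leq_addl.
(* Membership of x is settled at node x + 1, since node n fixes at least the first n values. *)
pose b x := bit x (nF (t x.+1)).
have bE n x : x < nl (t n) -> b x = bit x (nF (t n)).
  move=> xn; rewrite /b; have [le|/ltnW le] := leqP n x.+1; first exact: coh.
  by rewrite (coh x.+1 n)//; exact: nl_ge.
have FA n x : x < nl (t n) -> bit x (nF (t n)) -> A x.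
  elim: n => [|n IH]; first by rewrite t0.
  move=> xn; have [xn'|nx] := ltnP x (nl (t n)).
    by rewrite (coh n n.+1)//; exact: IH.
  by have [_ _ _ H _] := ct n; apply: H; rewrite nx.
have ncs_mono n m en : n <= m -> en \in ncs (t n) -> en \in ncs (t m).
  move=> /subnK <- H; elim: (m - n) => // k IH; rewrite addSn.
  have [_ _ _ _ [_ [[->]|[i ->]]]] := ct (k + n) => //.
  by rewrite inE IH orbT.
exists [set x | b x]; split=> [x /=|fin|PA].
- by rewrite (bE x.+1) => [|]; [apply: FA; exact: nl_ge|exact: nl_ge].
- have [s sE] := fin; have /finite_seqP[s' s'E] := fin.
  (* A node beyond all elements of the assumed finite list acquires a still larger element. *)
  have [_ _ [x /andP[lx xl] Fx] _ _] := ct (\max_(y <- s') y.+1).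
  have : [set x | b x] x by rewrite /= (bE _ _ xl).
  rewrite s'E /= => xs'; have := @leq_bigmax_seq _ s' xpredT succn x xs' isT.
  have := leq_trans (nl_ge _) lx; move: (\max_(y <- s') y.+1) => M; lia.
have [g gf /computable_from_Phi[e [He1 He2]]] := PA f pcf.
have memE x : (x \in [set x | b x]) = b x by exact: (asboolb (b x)).
have [_ _ _ _ [_]] := ct e; rewrite lev => -[[_ [x [y [v [HP fx yv]]]]]|[i ei]].
  apply: yv; rewrite -(gf x v fx); apply: (He2 x (nl (t e.+1))).
  by rewrite (@Phi_use _ _ (bit^~ (nF (t e.+1))))// => j lt; rewrite memE; exact: bE.
(* Node [m] has the divergence recorded and fixes the oracle at least up to the use s. *)
have [s Hs] := He1 i; pose m := maxn e.+1 s.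
have em : (e, i) \in ncs (t m).
  by apply: ncs_mono (leq_maxl _ _) _; rewrite ei mem_head.
pose B' x := (x < nl (t m)) && bit x (nF (t m)).
have : ~~ Phi e B' s i (g i).
  apply: okt em; split=> [x lt|x le]; first by rewrite /B' lt.
  by rewrite /B' ltnNge le.
rewrite (@Phi_use _ _ (fun x => x \in [set x | b x])) ?Hs// => j js.
have jm : j < nl (t m) by apply: leq_trans js (leq_trans (leq_maxr _ _) (nl_ge m)).
by rewrite /B' jm memE -bE.
Qed.

(** * From positive lower density to windows *)

Module Density.
Import topology normedtype sequences.
Import Order.TTheory GRing.Theory Num.Theory.
Local Open Scope ring_scope.

(** The lower limit of a bounded sequence is the supremum of its tail infima, so one of these is
    already positive. *)
Lemma lower_density_gt0 (R : realType) (A : set nat) : 0 < lower_density R A ->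
  exists2 d : R, 0 < d & exists N, forall n, (N <= n)%N ->
    d * n.+1%:R <= (\sum_(0 <= i < n.+1) (i \in A))%:R.
Proof.
rewrite /lower_density; set u := fun n : nat => _.
have u01 n : 0 <= u n <= 1.
  rewrite /u divr_ge0//= ler_pdivrMr ?ltr0Sn// mul1r ler_nat.
  by rewrite -[X in (_ <= X)%N]card_ord max_card.
have bu : bounded_fun u.
  exists 1; split=> // x x1 n _ /=.
  have /andP[u0 u1] := u01 n; rewrite ger0_norm//.
  exact: le_trans u1 (ltW x1).
rewrite limn_infE// => /sup_gt[|d [N _ <-] d0].
  by exists (infs u 0), 0%N.
exists (infs u N) => //; exists N => n Nn.
rewrite -ler_pdivlMr ?ltr0Sn//.
have -> : (\sum_(0 <= i < n.+1) (i \in A))%:R / n.+1%:R = u n.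
  by rewrite /u big_mkord -sum1_card [in RHS]big_mkcond /=; congr (_%:R / _).
apply: ge_inf; last by exists n.
by exists 0 => _ [k _ <-]; have /andP[] := u01 k.
Qed.

Lemma windows (R : realType) (A : set nat) : 0 < lower_density R A ->
  exists C, almost_all (fun n => (n <= cnt C (fun x => x \in A) n)%N).
Proof.
move=> /lower_density_gt0[d d0 [N HN]].
(* From C d >= 2, [A] has at least 2 n elements below C n, and at most n of them lie below n. The
   threshold [N.+1] makes n positive and C n - 1 >= N. *)
pose C := (Num.truncn (2 / d)).+1; exists C, N.+1 => n Nn.
have Cn : (n <= C * n)%N by rewrite leq_pmull.
have n0 : (0 < n)%N by exact: leq_trans Nn.
have CnE : (C * n).-1.+1 = (C * n)%N by rewrite prednK// muln_gt0.
have := HN (C * n).-1; rewrite CnE => H.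
have {}H : d * (C * n)%:R <= (\sum_(0 <= i < C * n) (i \in A))%:R by apply: H; lia.
have d2 : 2 <= d * C%:R.
  rewrite mulrC -ler_pdivrMr//; apply: ltW; exact: truncnS_gt.
have H2 : (2 * n <= \sum_(0 <= i < C * n) (i \in A))%N.
  rewrite -(ler_nat R); apply: le_trans H.
  by rewrite !natrM mulrA ler_wpM2r.
have H3 : (\sum_(0 <= i < C * n) (i \in A) <= n + cnt C (fun x => x \in A) n)%N.
  rewrite /cnt (big_cat_nat (leq0n n) Cn) /= leq_add//.
    rewrite -[X in (_ <= X)%N]muln1 -[X in (_ <= X * _)%N]subn0.
    by rewrite -sum_nat_const_nat; apply: leq_sum => i _; case: (_ \in _).
  rewrite (big_cat_nat (leq0n n) Cn) /= -[X in (X <= _)%N]add0n leq_add//.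
  rewrite big_nat [X in (_ <= X)%N]big_nat; apply: leq_sum => i /andP[-> _].
  by [].
by lia.
Qed.

End Density.

Theorem theorem1p4 (R : realType) (A : set nat)
    (posA : (0 < lower_density R A)%R) :
  exists B : set nat, [/\ B `<=` A, infinite_set B & ~ PA_degree B].
Proof.
have [C HC] := Density.windows posA; have [f pcf Hf] := diagonal_function.
have [t [t0 ct okt]] := node_chain Hf HC.
have [B [BA Binf BPA]] := chain_union t0 ct okt pcf.
by exists B; split=> // x /BA; rewrite inE.
Qed.
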